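(* Let $m,n,k$ be integers with $1\le k\le\min(m,n)$. Let $M$ be an $m\times n$ matrix in which each entry is either the constant $0$ or an exponential random variable with an arbitrary positive rate, all the random entries being independent. Let $Z$ be the set of positions of the zero entries. Assume that $Z$ contains $k-1$ zeros in independent position, i.e. $\mathrm{E}[\min_{k-1}(M)]=0$, and that the poset $Q_{k,Z}$ of critical rectangles is non-empty. Then we can write $$L({\min}_k(M),t)=\sum_{R\in Q_{k,Z}}c_R(M)\,\phi(R,t),\qquad \phi(R,t)=\frac{I(R)}{I(R)+t}.$$ Furthermore $c_R(M)=a_R\cdot b_R$, where $$a_R=\sum_{R_1<R_2<\dots<R_s=R}(-1)^{s}\prod_{i=1}^{s-1}\frac{I(R_i\cap R_{i+1})-I(R)}{I(R_i)-I(R)}$$ and $$b_R=\sum_{R=R_s<R_{s+1}<\dots<R_u}(-1)^{u-s+1}\prod_{i=s+1}^{u}\frac{I(R_i\cap R_{i-1})-I(R)}{I(R_i)-I(R)},$$ the first sum being over all chains in $Q_{k,Z}$ ending in $R$ (with $s\ge 1$) and the second over all chains in $Q_{k,Z}$ beginning in $R$ (with $u\ge s$; only the length $u-s+1$ of the chain varies, the starting index $s$ being immaterial). In the generic case (that is, when $I(R)\ne I(R')$ for every $R'\in Q_{k,Z}$, $R'\neq R$, with $R'\le R$ or $R\le R'$) this can be rewritten as $$c_R(M)=\Bigl(\sum_{R'\le R}g_R^{-1}(R',R)\Bigr)\cdot\Bigl(\sum_{R\le R'}g_R^{-1}(R,R')\Bigr),$$ where the sums are over elements $R'$ of $Q_{k,Z}$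 and where $g_R^{-1}$ is the inverse in the incidence algebra of $$g_R(R_i,R_j)=\begin{cases}1,&\text{if }R_i=R_j=R,\\ 0,&\text{if }R_i\nleq R_j,\\ I(R_i\cap R_j)-I(R),&\text{otherwise.}\end{cases}$$
   Context: A $k$-assignment in an $m\times n$ matrix is a collection of $k$ entries (positions) no two of which are in the same row or the same column; its value is the sum of its entries. $\min_k(M)$ denotes the minimum value of a $k$-assignment in $M$; it is a random variable when the entries of $M$ are. Zeros are in independent position if no two of them are in the same row or the same column. A random variable $X$ is exponential with rate $a>0$ if $P(X>t)=e^{-at}$ for $t\ge 0$. The Laplace transform of a random variable $X$ is $L(X,t)=\mathrm{E}[e^{-tX}]$. Let $\alpha$ be a set of rows and columns of the matrix. It covers $Z$ if every position in $Z$ lies in a row of $\alpha$ or in a column of $\alpha$. A $(k-1)$-cover is a cover of $Z$ consisting of $k-1$ rows and columns in total. The rectangle $R(\alpha)$ is the set of positions of the matrix lying neither in a row of $\alpha$ nor in a column of $\alpha$. If $\alpha$ is a $(k-1)$-cover of $Z$, then $R(\alpha)$ is called critical; $Q_{k,Z}$ is the set of all critical rectangles. It is partially ordered by: $R(\alpha)\le R(\beta)$ if the set of columns in $\alpha$ is a subset of the set of columns in $\beta$ and the set of rows in $\alpha$ is a superset of the set of rows in $\beta$. For a set $R$ of positions containing no position of $Z$ (such as a critical rectangle or an intersection of critical rectangles), its rate $I(R)$ is the sum of the rates of the entries of $M$ at the positions in $R$ (so $I(\emptyset)=0$); for a critical rectangle $I(R)>0$. The function $\phi(R,t)$ is the Laplace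 transform of the minimum of the entries of $M$ in $R$. The incidence algebra of a finite poset is the algebra of real-valued functions $g(x,y)$ defined on pairs $x\le y$ (extended by $0$ to other pairs), with product $(gh)(x,y)=\sum_{x\le z\le y}g(x,z)h(z,y)$; its identity is $\delta(x,y)=1$ if $x=y$ and $0$ otherwise. The value $g^{-1}(x,y)$ of an inverse depends only on the values of $g$ on the interval $[x,y]$, so the values of $g_R^{-1}$ used above involve only elements of $Q_{k,Z}$ comparable to $R$. Empty products are $1$.
   Formalization: The expansion with c_R = a_R·b_R is proved when I(R) ≠ I(R') for all comparable distinct R, R' (otherwise a_R, b_R have zero denominators and the expansion can fail); for other rates it is proved as a limit along generic rates. *)

(* Defs.v *)
From HB Require Import structures.
From mathcomp Require Import all_boot all_order all_algebra.
From mathcomp Require Import all_classical all_reals all_analysis.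
Import Order.TTheory GRing.Theory Num.Theory.
Import numFieldNormedType.Exports.
Set Implicit Arguments.
Unset Strict Implicit.
Unset Printing Implicit Defensive.
Local Open Scope ring_scope.

Notation pos m n := ('I_m * 'I_n)%type.
Notation rectangle m n := {set pos m n}.

(* The minimum of f over a finite set A; it is meaningful for A nonempty
   (the value is 0 when A is empty). *)
Definition fin_min (R : realType) (I : finType) (A : {set I}) (f : I -> R) : R :=
  fine (\big[mine/+oo%E]_(i in A) (f i)%:E).

Section Probability.
Context (R : realType) (d : measure_display) (T : measurableType d).
Variable P : probability T R.

Definition exponential_rv (X : T -> R) (a : R) : Prop :=
  0 < a /\
  forall t, 0 <= t -> P [set w | t < X w]%classic = (expR (- (a * t)))%:E.

(* Mutual independence of the family (X i), i in D: the product rule holds for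
   every finite subfamily. *)
Definition mutually_independent (I : finType) (D : {set I})
    (X : I -> {RV P >-> R}) : Prop :=
  forall (J : {set I}) (B : I -> set R),
    J \subset D -> (forall i, measurable (B i)) ->
    P [set w | forall i, i \in J -> B i (X i w)]%classic =
    (\prod_(i in J) P (X i @^-1` B i)%classic)%E.

Definition laplace (X : T -> R) (t : R) : \bar R :=
  ('E_P[fun w => expR (- (t * X w))])%E.

End Probability.

Section Assignments.
Context (m n : nat).

Definition independent_position (A : {set pos m n}) : bool :=
  [forall p in A, forall q in A,
     (p != q) ==> (p.1 != q.1) && (p.2 != q.2)].

Definition assignments (k : nat) : {set {set pos m n}} :=
  [set A : {set pos m n} | (#|A| == k) && independent_position A]%SET.

Definition min_assignment (R : realType) (k : nat) (M : pos m n -> R) : R :=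
  fin_min (assignments k) (fun A => \sum_(p in A) M p).

(* A set of rows and columns is encoded as the pair (rows, columns). *)
Definition lines := ({set 'I_m} * {set 'I_n})%type.

Definition covered (al : lines) (p : pos m n) : bool :=
  (p.1 \in al.1) || (p.2 \in al.2).

Definition is_cover (j : nat) (Z : {set pos m n}) (al : lines) : bool :=
  (#|al.1| + #|al.2| == j)%N && [forall p in Z, covered al p].

Definition rect_of (al : lines) : rectangle m n :=
  [set p | ~~ covered al p]%SET.

Definition critical (k : nat) (Z : {set pos m n}) : {set rectangle m n} :=
  [set rect_of al | al : lines in [pred al | is_cover k.-1 Z al]]%SET.

Definition rect_le (k : nat) (Z : {set pos m n}) : rel (rectangle m n) :=
  fun S S' =>
  [exists al : lines, exists be : lines,
    [&& is_cover k.-1 Z al, is_cover k.-1 Z be,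
        S == rect_of al, S' == rect_of be,
        al.2 \subset be.2 & be.1 \subset al.1]].

Definition rect_lt (k : nat) (Z : {set pos m n}) : rel (rectangle m n) :=
  fun S S' => (S != S') && rect_le k Z S S'.

Definition rect_comparable (k : nat) (Z : {set pos m n}) (S : rectangle m n) :
    {set rectangle m n} :=
  [set S' in critical k Z | rect_le k Z S' S || rect_le k Z S S']%SET.

(* c lists the elements of a chain of Q_{k,Z} in increasing order. *)
Definition is_chain (k : nat) (Z : {set pos m n}) (c : seq (rectangle m n)) : bool :=
  sorted (rect_lt k Z) c && all (mem (critical k Z)) c.

End Assignments.

Section Coefficients.
Context (R : realType) (m n : nat).
Variables (k : nat) (Z : {set pos m n}) (rate : pos m n -> R).
Implicit Types S : rectangle m n.

Definition rect_rate S : R := \sum_(p in S) rate p.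

(* Chains are indexed from 0 and have l.+1 elements. Chains are strict, so none
   has more than #|critical k Z| elements. *)
Definition coef_a S : R :=
  \sum_(l < #|critical k Z|)
  \sum_(c : l.+1.-tuple (rectangle m n) | is_chain k Z c && (last finset.set0 c == S))
    (-1) ^+ l.+1 *
    \prod_(i < l)
      ((rect_rate (nth finset.set0 c i :&: nth finset.set0 c i.+1) - rect_rate S)
       / (rect_rate (nth finset.set0 c i) - rect_rate S)).

Definition coef_b S : R :=
  \sum_(l < #|critical k Z|)
  \sum_(c : l.+1.-tuple (rectangle m n) | is_chain k Z c && (head finset.set0 c == S))
    (-1) ^+ l.+1 *
    \prod_(i < l)
      ((rect_rate (nth finset.set0 c i.+1 :&: nth finset.set0 c i) - rect_rate S)
       / (rect_rate (nth finset.set0 c i.+1) - rect_rate S)).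

Definition coef_c S : R := coef_a S * coef_b S.

(* The denominators in coef_a S and coef_b S are nonzero exactly when
   generic_at S holds. *)
Definition generic_at S : Prop :=
  forall S', S' \in critical k Z -> S' != S ->
    rect_le k Z S' S \/ rect_le k Z S S' -> rect_rate S <> rect_rate S'.

Definition generic : Prop :=
  forall S, S \in critical k Z -> generic_at S.

Definition g_fun S (Si Sj : rectangle m n) : R :=
  if (Si == S) && (Sj == S) then 1
  else if ~~ rect_le k Z Si Sj then 0
  else rect_rate (Si :&: Sj) - rect_rate S.

End Coefficients.

Section IncidenceAlgebra.
Context (R : realType) (I : finType).
Variables (Q : {set I}) (le : rel I).

(* Elements of the incidence algebra of the finite poset (Q, le) are functions
   on I * I; only their values on Q * Q matter. *)
Definition incidence (g : I -> I -> R) : Prop :=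
  forall x y, x \in Q -> y \in Q -> ~~ le x y -> g x y = 0.

Definition incidence_mul (g h : I -> I -> R) (x y : I) : R :=
  \sum_(z in Q | le x z && le z y) g x z * h z y.

Definition incidence_inverse (g h : I -> I -> R) : Prop :=
  [/\ incidence h,
      (forall x y, x \in Q -> y \in Q -> incidence_mul g h x y = (x == y)%:R)
    & (forall x y, x \in Q -> y \in Q -> incidence_mul h g x y = (x == y)%:R)].

End IncidenceAlgebra.

(* Main.v *)
(* With k-1 independent zeros, min_k(M) is a first-passage time from the free rows
   to the free columns, and the critical rectangles are the cuts. Hence
   min_k(M) = X + min_k(M'), where X is the least entry in the minimum rectangle
   R0 of Q_{k,Z} and M' subtracts X from R0, creating a new zero. By memorylessness
   the new zero sits at p with probability proportional to the rate of p, and M' is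
   otherwise distributed as M, so that
     (I(R0) + t) L_Z(t) = \sum_(p in R0) rate p * L_{Z + p}(t).
   This recursion is solved by L_Z(t) = 1 - t \sum_(y in Q_{k,Z}) v(y), where v solves
   \sum_(y >= x) (I(x :&: y) + t) v(y) = 1 for all x. The matrix (I(x :&: y)) over
   x <= y is triangular with diagonal I; expanding v along the eigenvectors of its
   pencil with the zeta matrix gives the partial fractions, the eigenvectors being
   the sums over chains that occur in a_R and b_R. *)
Require Import Defs.
From HB Require Import structures.
From mathcomp Require Import all_boot all_order all_algebra.
From mathcomp Require Import all_classical all_reals all_analysis.
From mathcomp Require Import measurable_realfun.
From mathcomp Require Import zify ring.
Import Order.TTheory GRing.Theory Num.Theory.
Import numFieldNormedType.Exports.
Set Implicit Arguments.
Unset Strict Implicit.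
Unset Printing Implicit Defensive.
Local Open Scope ring_scope.

(** * Covers and assignments *)

Section Covers.
Context (m n : nat).
Implicit Types (A B Z : {set pos m n}) (al be : lines m n).

Definition covers Z al := [forall p in Z, covered al p].
Definition lsize al := (#|al.1| + #|al.2|)%N.
Definition lmeet al be : lines m n := (al.1 :|: be.1, al.2 :&: be.2).
Definition ljoin al be : lines m n := (al.1 :&: be.1, al.2 :|: be.2).

Lemma coversP Z al : reflect (forall p, p \in Z -> covered al p) (covers Z al).
Proof. exact: forall_inP. Qed.

Lemma lsize_meet_join al be :
  (lsize (lmeet al be) + lsize (ljoin al be) = lsize al + lsize be)%N.
Proof.
rewrite /lsize /=.
by rewrite addnACA cardsUI [X in (_ + X)%N]addnC cardsUI addnACA.
Qed.

Lemma lsize_add_row u al : (lsize (u |: al.1, al.2) <= (lsize al).+1)%N.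
Proof. by rewrite /lsize /= cardsU1 -addnA -add1n leq_add2r; case: (_ \notin _). Qed.

Lemma lsize_add_col v al : (lsize (al.1, v |: al.2) <= (lsize al).+1)%N.
Proof.
by rewrite /lsize /= cardsU1 addnCA -add1n leq_add2r; case: (_ \notin _).
Qed.

Lemma covers_meet Z al be : covers Z al -> covers Z be -> covers Z (lmeet al be).
Proof.
move=> /coversP ha /coversP hb; apply/coversP => p pZ.
move: (ha p pZ) (hb p pZ); rewrite /covered /= !inE.
by case: (p.1 \in al.1); case: (p.1 \in be.1) => //= -> ->.
Qed.

Lemma covers_join Z al be : covers Z al -> covers Z be -> covers Z (ljoin al be).
Proof.
move=> /coversP ha /coversP hb; apply/coversP => p pZ.
move: (ha p pZ) (hb p pZ); rewrite /covered /= !inE.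
by case: (p.2 \in al.2); case: (p.2 \in be.2) => //=; rewrite ?orbF ?orbT // => -> ->.
Qed.

Lemma indepP A : reflect
  (forall p q, p \in A -> q \in A -> p.1 = q.1 \/ p.2 = q.2 -> p = q)
  (independent_position A).
Proof.
apply: (iffP forall_inP) => [h p q pA qA e|h p pA].
  apply/eqP; apply: contraT => npq.
  have /forall_inP/(_ q qA) := h p pA; rewrite npq /=.
  by case/andP => /eqP n1 /eqP n2; case: e.
apply/forall_inP => q qA; apply/implyP => npq; apply/andP; split;
  apply: contra npq => /eqP e; apply/eqP; apply: h => //; [by left|by right].
Qed.

Lemma indep_sub A B : A \subset B -> independent_position B -> independent_position A.
Proof.
move=> /fintype.subsetP s /indepP h; apply/indepP => p q pA qA; apply: h; exact: s.
Qed.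

Lemma card_rows A : independent_position A -> #|[set p.1 | p in A]%SET| = #|A|.
Proof.
move=> /indepP h; apply: card_in_imset => p q pA qA e; apply: h => //; by left.
Qed.

Lemma card_cols A : independent_position A -> #|[set p.2 | p in A]%SET| = #|A|.
Proof.
move=> /indepP h; apply: card_in_imset => p q pA qA e; apply: h => //; by right.
Qed.

Lemma indep_setU1 A p : independent_position A ->
  (forall q, q \in A -> p.1 != q.1 /\ p.2 != q.2) -> independent_position (p |: A).
Proof.
move=> /indepP h hp; apply/indepP => q r; rewrite !inE => /orP[/eqP->|qA] /orP[/eqP->|rA] //.
- by move: (hp r rA) => [/eqP n1 /eqP n2] [].
- by move: (hp q qA) => [/eqP n1 /eqP n2] [] e; [case: n1|case: n2].
- exact: h.
Qed.

Lemma indep_cover_leq A al : independent_position A -> covers A al -> (#|A| <= lsize al)%N.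
Proof.
move=> iA /coversP cA.
have : A \subset [set p in A | p.1 \in al.1]%SET :|: [set p in A | p.2 \in al.2]%SET.
  by apply/fintype.subsetP => p pA; rewrite !inE pA /=; exact: cA.
move=> /subset_leq_card /leq_trans -> //.
apply: leq_trans (leq_card_setU _ _) _.
apply: leq_add.
  rewrite -card_rows; last first.
    by apply: indep_sub iA; apply/fintype.subsetP => p; rewrite inE => /andP[].
  by apply: subset_leq_card; apply/fintype.subsetP => u /imsetP[p]; rewrite inE => /andP[_ h] ->.
rewrite -card_cols; last by apply: indep_sub iA; apply/fintype.subsetP => p; rewrite inE => /andP[].
by apply: subset_leq_card; apply/fintype.subsetP => u /imsetP[p]; rewrite inE => /andP[_ h] ->.
Qed.

(* Lovász: in a set of positions whose minimum cover number drops whenever a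
   position is removed, no two positions share a line. *)
Lemma konig j Z : (forall al, covers Z al -> (j <= lsize al)%N) ->
  exists2 A, A \in assignments m n j & A \subset Z.
Proof.
elim: {Z}#|Z| {-2}Z (leqnn #|Z|) => [|N IH] Z hN hZ.
  have Z0 : Z = finset.set0 by apply/eqP; rewrite -cards_eq0 -leqn0.
  have j0 : j = 0%N.
    apply/eqP; rewrite -leqn0.
    have := hZ (finset.set0, finset.set0); rewrite /lsize /= !cards0; apply.
    by apply/coversP => p; rewrite Z0 inE.
  exists finset.set0; last by rewrite finset.sub0set.
  rewrite inE cards0 j0 eqxx /=; apply/indepP => p q; by rewrite inE.
case: (pickP (fun e => (e \in Z) && [forall al, covers (Z :\ e) al ==> (j <= lsize al)%N])).
  move=> e /andP[eZ /forallP h].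
  have [||A Aj As] := IH (Z :\ e).
  - by move: hN; rewrite (cardsD1 e Z) eZ.
  - by move=> al c; apply: (implyP (h al)).
  - exists A => //; apply: fintype.subset_trans As _; exact: finset.subD1set.
move=> hcrit.
have crit e : e \in Z -> exists al, [/\ covers (Z :\ e) al, (lsize al < j)%N & ~~ covered al e].
  move=> eZ; move: (hcrit e); rewrite eZ /= => /negbT; rewrite negb_forall => /existsP[al].
  rewrite negb_imply -ltnNge => /andP[c l]; exists al; split=> //.
  apply/negP => ce; move: l; rewrite ltnNge hZ //; apply/coversP => p pZ.
  have [->//|ne] := eqVneq p e; by move/coversP: c; apply; rewrite !inE ne.
have iZ : independent_position Z.
  apply/indepP => e f eZ fZ hor; apply/eqP; apply: contraT => nef.
  have [al [/coversP ca la na]] := crit e eZ.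
  have [be [/coversP cb lb nb]] := crit f fZ.
  have caf : covered al f by apply: ca; rewrite !inE eq_sym nef.
  have cbe : covered be e by apply: cb; rewrite !inE nef.
  have := lsize_meet_join al be.
  have g p : p \in Z -> p != e -> p != f -> covered al p /\ covered be p.
    by move=> pZ pe pf; split; [apply: ca|apply: cb]; rewrite !inE ?pe ?pf.
  case: hor => hl.
    have ha : f.2 \in al.2.
      by move: caf; rewrite /covered -hl; case/orP => // h; move: na; rewrite /covered h.
    have hb : e.2 \in be.2.
      by move: cbe; rewrite /covered hl; case/orP => // h; move: nb; rewrite /covered h.
    have c1 : covers Z (ljoin al be).
      apply/coversP => p pZ; rewrite /covered /= !inE.
      have [->|pe] := eqVneq p e; first by rewrite hb !orbT.
      have [->|pf] := eqVneq p f; first by rewrite ha !orbT.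
      have [] := g p pZ pe pf; rewrite /covered.
      by case: (p.2 \in al.2); case: (p.2 \in be.2); rewrite ?orbT ?orbF //= => -> ->.
    have c2 : covers Z (e.1 |: (lmeet al be).1, (lmeet al be).2).
      apply/coversP => p pZ; rewrite /covered /= !inE.
      have [->|pe] := eqVneq p e; first by rewrite eqxx.
      have [->|pf] := eqVneq p f; first by rewrite hl eqxx.
      have [] := g p pZ pe pf; rewrite /covered.
      by case: (p.1 \in al.1); case: (p.1 \in be.1); rewrite ?orbT ?orbF //= => -> ->; rewrite orbT.
    by have := hZ _ c1; have := leq_trans (hZ _ c2) (lsize_add_row _ _); lia.
  have ha : f.1 \in al.1.
    by move: caf; rewrite /covered -hl; case/orP => // h; move: na; rewrite /covered h orbT.
  have hb : e.1 \in be.1.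
    by move: cbe; rewrite /covered hl; case/orP => // h; move: nb; rewrite /covered h orbT.
  have c1 : covers Z (lmeet al be).
    apply/coversP => p pZ; rewrite /covered /= !inE.
    have [->|pe] := eqVneq p e; first by rewrite hb !orbT.
    have [->|pf] := eqVneq p f; first by rewrite ha.
    have [] := g p pZ pe pf; rewrite /covered.
    by case: (p.1 \in al.1); case: (p.1 \in be.1); rewrite ?orbT ?orbF //= => -> ->.
  have c2 : covers Z ((ljoin al be).1, e.2 |: (ljoin al be).2).
    apply/coversP => p pZ; rewrite /covered /= !inE.
    have [->|pe] := eqVneq p e; first by rewrite eqxx !orbT.
    have [->|pf] := eqVneq p f; first by rewrite hl eqxx !orbT.
    have [] := g p pZ pe pf; rewrite /covered.
    by case: (p.2 \in al.2); case: (p.2 \in be.2); rewrite ?orbT ?orbF //= => -> ->; rewrite ?orbT.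
  by have := hZ _ c1; have := leq_trans (hZ _ c2) (lsize_add_col _ _); lia.
have jZ : (j <= #|Z|)%N.
  have := hZ ([set p.1 | p in Z]%SET, finset.set0).
  rewrite /lsize /= cards0 addn0 card_rows //; apply.
  by apply/coversP => p pZ; rewrite /covered /= imset_f.
have /card_geqP[s [us ss sZ]] := jZ.
have sZ' : [set:: s] \subset Z by apply/fintype.subsetP => p; rewrite inE; exact: sZ.
exists [set:: s] => //.
by rewrite inE (indep_sub sZ' iZ) andbT cardsE (card_uniqP us) ss.
Qed.

Lemma exchange (mu A : {set pos m n}) :
  independent_position mu -> independent_position A -> (#|mu| < #|A|)%N ->
  exists B : {set pos m n}, exists r : 'I_m,
    [/\ B \subset A :|: mu, independent_position B, r \notin [set p.1 | p in mu]%SET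
      & [set p.1 | p in B]%SET = r |: [set p.1 | p in mu]%SET].
Proof.
move: {2}#|mu| (leqnn #|mu|) => N; elim: N mu A => [|N IH] mu A hN imu iA lt.
- have mu0 : mu = finset.set0 by apply/eqP; rewrite -cards_eq0 -leqn0.
  have /card_gt0P[p pA] : (0 < #|A|)%N by apply: leq_ltn_trans lt.
  exists [set p]%SET, p.1; split.
  + by rewrite finset.sub1set inE pA.
  + by apply/indepP => x y; rewrite !inE => /eqP-> /eqP->.
  + by rewrite mu0 finset.imset0 inE.
  + by rewrite mu0 finset.imset0 finset.imset_set1 finset.setU0.
- have /subsetPn[r1 /imsetP[p1 p1A ->{r1}] r1mu] :
    ~~ ([set p.1 | p in A]%SET \subset [set p.1 | p in mu]%SET).
    apply/negP => /subset_leq_card; rewrite !card_rows // => h.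
    by move: lt; rewrite ltnNge h.
  case: (boolP (p1.2 \in [set p.2 | p in mu]%SET)); last first.
    move=> cmu; exists (p1 |: mu), p1.1; split=> //.
    + by apply: finset.setSU; rewrite finset.sub1set.
    + apply: indep_setU1 => // q qmu; split.
        by apply: contra r1mu => /eqP ->; apply: imset_f.
      by apply: contra cmu => /eqP ->; apply: imset_f.
    + by rewrite finset.imsetU1.
  case/imsetP => p2 p2mu e12.
  have p1nmu : p1 \notin mu by apply: contra r1mu => h; apply: imset_f.
  have cmu : #|mu| = #|mu :\ p2|.+1 by rewrite (cardsD1 p2 mu) p2mu.
  have cA : #|A| = #|A :\ p1|.+1 by rewrite (cardsD1 p1 A) p1A.
  have [||||B [r [sB iB rB eB]]] := IH (mu :\ p2) (A :\ p1).
  + by move: hN; rewrite cmu.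
  + by apply: indep_sub imu; exact: finset.subD1set.
  + by apply: indep_sub iA; exact: finset.subD1set.
  + by move: lt; rewrite cmu cA.
  have rowsmu : [set p.1 | p in mu]%SET = p2.1 |: [set p.1 | p in mu :\ p2]%SET.
    by rewrite -finset.imsetU1 finset.setD1K.
  have hB q : q \in B -> [/\ q.1 != p1.1, q.2 != p1.2 & q \in A :|: mu].
    move=> qB; move/fintype.subsetP: sB => /(_ q qB); rewrite !inE.
    case/orP => /andP[nq qA]; rewrite qA ?orbT; split=> //.
    * by apply: contra nq => /eqP e; apply/eqP/(indepP _ iA) => //; left.
    * by apply: contra nq => /eqP e; apply/eqP/(indepP _ iA) => //; right.
    * by apply: contra r1mu => /eqP <-; apply: imset_f.
    * by apply: contra nq; rewrite e12 => /eqP e; apply/eqP/(indepP _ imu) => //; right.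
  have sBU p : p \in A :|: mu -> p |: B \subset A :|: mu.
    move=> pAm; apply/fintype.subsetP => q; rewrite finset.in_setU1 => /orP[/eqP->//|/hB[]//].
  have [rp2|nrp2] := eqVneq r p2.1.
    exists (p1 |: B), p1.1; split=> //.
    * by apply: sBU; rewrite inE p1A.
    * apply: indep_setU1 => // q /hB[n1 n2 _]; by rewrite !(eq_sym p1.1, eq_sym p1.2).
    * by rewrite finset.imsetU1 eB rowsmu rp2.
  have p2rowB q : q \in B -> p2.1 != q.1.
    move=> qB; apply/negP => /eqP e.
    have : p2.1 \in [set p.1 | p in B]%SET by rewrite e imset_f.
    rewrite eB finset.in_setU1 eq_sym (negbTE nrp2) /=.
    case/imsetP => q'; rewrite !inE => /andP[nq' q'mu] e'.
    by move/eqP: nq'; apply; apply: (indepP _ imu) => //; left.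
  exists (p2 |: B), r; split=> //.
  * by apply: sBU; rewrite inE p2mu orbT.
  * by apply: indep_setU1 => // q qB; split; [exact: p2rowB|rewrite -e12 eq_sym; case: (hB q qB)].
  * by rewrite rowsmu finset.in_setU1 negb_or nrp2.
  * by rewrite finset.imsetU1 eB rowsmu finset.setUCA.
Qed.

End Covers.

Section FinMin.
Context (R : realType) (I : finType).
Implicit Types (A : {set I}) (f g : I -> R).

Lemma fin_min_attained A f : A != finset.set0 ->
  exists2 i, i \in A & fin_min A f = f i.
Proof.
move=> /set0Pn[j jA].
have [|i iA e] := @eq_bigmin _ _ _ +oo%E j (mem A) (fun i => (f i)%:E) jA.
  by move=> i _; exact: leey.
by exists i => //; rewrite /fin_min e.
Qed.

Lemma fin_min_le A f i : i \in A -> fin_min A f <= f i.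
Proof.
move=> iA.
have [|j jA e] := @eq_bigmin _ _ _ +oo%E i (mem A) (fun i => (f i)%:E) iA.
  by move=> ? _; exact: leey.
by rewrite -lee_fin /fin_min e /= -e; exact: bigmin_le_cond.
Qed.

Lemma fin_min_ge A f c : A != finset.set0 -> (forall i, i \in A -> c <= f i) ->
  c <= fin_min A f.
Proof. by move=> A0 h; have [i iA ->] := fin_min_attained f A0; exact: h. Qed.

Lemma eq_fin_min A f g : {in A, f =1 g} -> fin_min A f = fin_min A g.
Proof. by move=> h; rewrite /fin_min; congr fine; apply: eq_bigr => i iA; rewrite h. Qed.

End FinMin.

Section MinCover.
Context (m n k : nat).
Implicit Types (A B Z : {set pos m n}) (al be : lines m n).

Definition independent_zeros Z :=
  exists2 A, A \in assignments m n k.-1 & A \subset Z.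

Definition minimum_cover Z al :=
  is_cover k.-1 Z al /\
  forall be, is_cover k.-1 Z be -> al.2 \subset be.2 /\ be.1 \subset al.1.

Lemma is_coverE Z al : is_cover k.-1 Z al = (lsize al == k.-1) && covers Z al.
Proof. by []. Qed.

Lemma covers_lsize Z al : independent_zeros Z -> covers Z al -> (k.-1 <= lsize al)%N.
Proof.
move=> [A]; rewrite inE => /andP[/eqP <- iA] /fintype.subsetP sA /coversP c.
apply: indep_cover_leq => //; apply/coversP => p /sA; exact: c.
Qed.

Lemma minimum_cover_exists Z al : independent_zeros Z -> is_cover k.-1 Z al ->
  exists be, minimum_cover Z be.
Proof.
move=> iZ cal.
have [be cbe hmin] := @arg_minnP _ al (is_cover k.-1 Z) (fun al => #|al.2|) cal.
exists be; split=> // ga cga.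
move: cbe cga; rewrite !is_coverE => /andP[/eqP sbe cbe] /andP[/eqP sga cga].
have c1 := covers_meet cbe cga; have c2 := covers_join cbe cga.
have e1 := covers_lsize iZ c1; have e2 := covers_lsize iZ c2.
have es := lsize_meet_join be ga.
have em : lsize (lmeet be ga) = k.-1 by move: es e1 e2; rewrite sbe sga; lia.
have lt : (#|be.2| <= #|(lmeet be ga).2|)%N by apply: hmin; rewrite is_coverE em eqxx.
have eq2 : (lmeet be ga).2 = be.2.
  by apply/eqP; rewrite eqEcard lt andbT; exact: finset.subsetIl.
have eq1 : be.1 = (lmeet be ga).1.
  apply/eqP; rewrite eqEcard finset.subsetUl /=.
  by move: em; rewrite /lsize -sbe /lsize eq2 => /eqP; rewrite eqn_add2r => /eqP ->.
split; first by rewrite -eq2 finset.subsetIr.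
by rewrite eq1 finset.subsetUr.
Qed.

Lemma rows_saturated Z al : independent_zeros Z -> is_cover k.-1 Z al ->
  exists mu : {set pos m n},
    [/\ mu \subset Z, independent_position mu, [set p.1 | p in mu]%SET = al.1
      & forall p, p \in mu -> p.2 \notin al.2].
Proof.
move=> [A]; rewrite inE => /andP[/eqP sA iA] AZ; rewrite is_coverE => /andP[/eqP s /coversP c].
pose mu := [set p in A | p.1 \in al.1]%SET; pose nu := [set p in A | p.2 \in al.2]%SET.
have smu : mu \subset A by apply/fintype.subsetP => p; rewrite inE => /andP[].
have snu : nu \subset A by apply/fintype.subsetP => p; rewrite inE => /andP[].
have imu := indep_sub smu iA; have inu := indep_sub snu iA.
have lmu : [set p.1 | p in mu]%SET \subset al.1.
  by apply/fintype.subsetP => u /imsetP[p]; rewrite inE => /andP[_ h] ->.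
have lnu : [set p.2 | p in nu]%SET \subset al.2.
  by apply/fintype.subsetP => u /imsetP[p]; rewrite inE => /andP[_ h] ->.
have e : mu :|: nu = A.
  apply/setP => p; rewrite !inE -andb_orr; case: (boolP (p \in A)) => //= pA.
  by apply: c; move/fintype.subsetP: AZ; apply.
have c1 := subset_leq_card lmu; have c2 := subset_leq_card lnu.
rewrite card_rows // in c1; rewrite card_cols // in c2.
have cUI := cardsUI mu nu; rewrite e sA -s in cUI.
have [c3 c4] : #|mu| = #|al.1| /\ #|mu :&: nu| = 0%N.
  move: cUI c1 c2; rewrite /lsize.
  by move: #|mu :&: nu| #|mu| #|nu| #|al.1| #|al.2|; lia.
exists mu; split=> //.
- exact: fintype.subset_trans smu AZ.
- by apply/eqP; rewrite eqEcard lmu /= card_rows // c3.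
- move=> p pmu; apply/negP => h; move/eqP: c4; rewrite cards_eq0 => /eqP/setP/(_ p).
  by move: pmu; rewrite !inE h => /andP[-> ->].
Qed.

Lemma cols_saturated Z al r : independent_zeros Z -> minimum_cover Z al ->
  r \notin al.1 ->
  exists nu : {set pos m n},
    [/\ nu \subset Z, nu \in assignments m n #|al.2|
      & forall p, p \in nu -> p.1 \notin r |: al.1 /\ p.2 \in al.2].
Proof.
move=> iZ [cal hmin] nr.
pose Z' := [set p in Z | (p.1 \notin r |: al.1) && (p.2 \in al.2)]%SET.
have [|A Aas AZ'] := @konig m n #|al.2| Z'.
  move=> be /coversP cbe; rewrite leqNgt; apply/negP => lt.
  pose ga : lines m n := (r |: (al.1 :|: be.1), al.2 :&: be.2).
  have cga : covers Z ga.
    apply/coversP => p pZ; rewrite /covered !inE.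
    have /orP[->|h2] : covered al p.
      by move: cal; rewrite is_coverE => /andP[_ /coversP]; apply.
      by rewrite orbT.
    case: (boolP (p.1 \in r |: al.1)); first by rewrite !inE orbA => ->.
    move=> h1; have : covered be p by apply: cbe; rewrite inE pZ h1.
    by rewrite /covered h2 => /orP[] ->; rewrite ?orbT.
  have sga : (lsize ga <= lsize al)%N.
    apply: leq_trans (lsize_add_row _ (_, _)) _.
    rewrite /lsize /= -addSn.
    have l1 := leq_card_setU al.1 be.1.
    have l2 := subset_leq_card (finset.subsetIr al.2 be.2).
    apply: (@leq_trans (#|al.1| + #|be.1| + #|be.2|).+1).
      by rewrite addSn ltnS; apply: leq_add; [exact: l1|exact: l2].
    by rewrite -addnA -addnS leq_add2l.
  have isga : is_cover k.-1 Z ga.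
    rewrite is_coverE cga andbT eqn_leq (covers_lsize iZ cga) andbT.
    by move: cal; rewrite is_coverE => /andP[/eqP <-].
  have [_ /fintype.subsetP/(_ r)] := hmin _ isga.
  by rewrite !inE eqxx (negbTE nr) => /(_ isT).
exists A; split=> //.
  by apply: fintype.subset_trans AZ' _; apply/fintype.subsetP => p; rewrite inE => /andP[].
by move=> p /(fintype.subsetP AZ'); rewrite inE => /and3P[].
Qed.

Lemma assignments_neq0 j : (j <= minn m n)%N -> assignments m n j != finset.set0.
Proof.
move=> jmn; have [|A Aj _] := @konig m n j [set: pos m n].
  move=> al /coversP c.
  have [/eqP h|h] := boolP (al.1 == finset.setT).
    apply: leq_trans jmn (leq_trans (geq_minl _ _) _).
    by rewrite /lsize h cardsT card_ord leq_addr.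
  have [/eqP h'|h'] := boolP (al.2 == finset.setT).
    apply: leq_trans jmn (leq_trans (geq_minr _ _) _).
    by rewrite /lsize h' cardsT card_ord leq_addl.
  have [i _ ni] : exists2 i : 'I_m, i \in [set: 'I_m]%SET & i \notin al.1.
    by apply/subsetPn; rewrite finset.subTset.
  have [j' _ nj] : exists2 j : 'I_n, j \in [set: 'I_n]%SET & j \notin al.2.
    by apply/subsetPn; rewrite finset.subTset.
  by have := c (i, j'); rewrite inE /covered /= (negbTE ni) (negbTE nj) => /(_ isT).
by apply/set0Pn; exists A.
Qed.

(* Every k-assignment meets R(al), al having only k-1 lines, and by exchange
   along an alternating path an optimal one meets it exactly once. *)
Lemma min_assignment_step (R : realType) Z al (x : pos m n -> R) p :
  (0 < k)%N -> (k <= minn m n)%N ->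
  independent_zeros Z -> minimum_cover Z al ->
  (forall q, 0 <= x q) -> (forall q, q \in Z -> x q = 0) ->
  p \in rect_of al -> (forall q, q \in rect_of al -> x p <= x q) ->
  min_assignment k x =
  x p + min_assignment k (fun q => if q \in rect_of al then x q - x p else x q).
Proof.
move=> k0 kmn iZ mal x0 xZ pal pmin.
set y := fun q => _.
have y0 q : 0 <= y q by rewrite /y; case: ifP => // qal; rewrite subr_ge0 pmin.
have yx q : y q <= x q by rewrite /y; case: ifP => // _; rewrite gerBl.
have [cal hmin] := mal.
have calZ : covers Z al by move: cal; rewrite is_coverE => /andP[].
have sal : lsize al = k.-1 by move: cal; rewrite is_coverE => /andP[/eqP].
have yZ q : q \in Z -> y q = 0.
  by move=> qZ; rewrite /y ifF ?xZ //; apply/negbTE; rewrite inE negbK; move/coversP: calZ; apply.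
have kA0 := assignments_neq0 kmn.
apply/eqP; rewrite eq_le; apply/andP; split; last first.
  apply: fin_min_ge => // A Ak.
  have := Ak; rewrite inE => /andP[/eqP sA iA].
  have /fintype.subsetPn[q qA nq] : ~~ (A \subset [set q | covered al q]%SET).
    apply/negP => sAc; suff : (#|A| <= lsize al)%N by rewrite sA sal; lia.
    by apply: indep_cover_leq => //; apply/coversP => q /(fintype.subsetP sAc); rewrite inE.
  have qal : q \in rect_of al by move: nq; rewrite !inE.
  apply: (@le_trans _ _ (x p + \sum_(i in A) y i)).
    by rewrite lerD2l; exact: fin_min_le.
  rewrite (bigD1 q) //= [leRHS](bigD1 q) //= addrA lerD //.
    by rewrite /y qal addrC subrK.
  exact: ler_sum.
have [A Ak yA] := fin_min_attained (fun A => \sum_(q in A) y q) kA0.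
rewrite [min_assignment k y]yA.
have := Ak; rewrite inE => /andP[/eqP sA iA].
pose A1 := [set q in A | q.2 \notin al.2]%SET.
have sA1 : A1 \subset A by apply/fintype.subsetP => q; rewrite inE => /andP[].
have iA1 := indep_sub sA1 iA.
have [mu [muZ imu rmu cmu]] := rows_saturated iZ cal.
have cA1 : (#|mu| < #|A1|)%N.
  rewrite -card_rows // rmu.
  pose A2 := [set q in A | q.2 \in al.2]%SET.
  have sA2 : A2 \subset A by apply/fintype.subsetP => q; rewrite inE => /andP[].
  have c2 : (#|A2| <= #|al.2|)%N.
    rewrite -card_cols; last exact: indep_sub iA.
    by apply: subset_leq_card; apply/fintype.subsetP => u /imsetP[q]; rewrite inE => /andP[_ h] ->.
  have e : A = A1 :|: A2.
    by apply/setP => q; rewrite !inE -andb_orr orNb andbT.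
  have := leq_card_setU A1 A2; rewrite -e sA => h.
  have h2 : (#|al.1| + #|al.2| < #|A1| + #|al.2|)%N.
    move: sal; rewrite /lsize => ->; rewrite prednK //.
    by apply: leq_trans h _; rewrite leq_add2l.
  by rewrite ltn_add2r in h2.
have [B [r [sB iB nr rB]]] := exchange imu iA1 cA1.
rewrite rmu in nr rB.
have [nu [nuZ nuas hnu]] := cols_saturated iZ mal nr.
have hB q : q \in B -> q.1 \in r |: al.1 /\ q.2 \notin al.2.
  move=> qB; split; first by rewrite -rB imset_f.
  have := fintype.subsetP sB q qB; rewrite !inE => /orP[/andP[]//|]; exact: cmu.
have dnuB : [disjoint nu & B].
  rewrite disjoint_subset; apply/fintype.subsetP => q qnu; rewrite inE; apply/negP => qB.
  by have [_ h1] := hnu q qnu; have [_] := hB q qB; rewrite h1.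
have iC : independent_position (nu :|: B).
  move: nuas; rewrite inE => /andP[_ /indepP inu]; move/indepP: iB => iB.
  have cross q q' : q \in nu -> q' \in B -> q.1 = q'.1 \/ q.2 = q'.2 -> False.
    move=> /hnu[a1 a2] /hB[b1 b2] [] e; first by rewrite e b1 in a1.
    by rewrite -e a2 in b2.
  apply/indepP => q q'; rewrite !inE => /orP[a|a] /orP[b|b].
  - exact: inu.
  - by move=> /(cross _ _ a b).
  - by move=> h; case: (cross _ _ b a); case: h => ->; [left|right].
  - exact: iB.
have Ck : nu :|: B \in assignments m n k.
  rewrite inE iC andbT.
  have cD : nu :&: B = finset.set0 by apply/eqP; rewrite finset.setI_eq0.
  rewrite cardsU cD cards0 subn0 -(card_rows iB) rB cardsU1 nr.
  move: nuas; rewrite inE => /andP[/eqP -> _] /=.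
  by rewrite addnCA addnC (addnC #|al.2|) -/(lsize al) sal addn1 prednK.
have : r \in [set q.1 | q in B]%SET by rewrite rB setU11.
case/imsetP => pr prB er.
have prA : pr \in rect_of al.
  by rewrite inE /covered negb_or -er nr /=; case: (hB pr prB).
have uniqB q : q \in nu :|: B -> q \in rect_of al -> q = pr.
  rewrite !inE /covered negb_or => /orP[qnu /andP[_]|qB /andP[nq1 _]].
    by have [_ ->] := hnu q qnu.
  have [] := hB q qB; rewrite !inE (negbTE nq1) orbF => /eqP e _.
  by apply: (indepP _ iB) => //; left; rewrite e.
have prU : pr \in nu :|: B by rewrite inE prB orbT.
apply: le_trans (fin_min_le _ Ck) _.
rewrite (bigD1 pr) //=.
have -> : \sum_(q in nu :|: B | q != pr) x q = \sum_(q in nu :|: B | q != pr) y q.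
  apply: eq_bigr => q /andP[qU nq]; rewrite /y ifF //; apply/negbTE.
  by apply: contra nq => h; apply/eqP; exact: uniqB.
have -> : x pr = x p + y pr by rewrite /y prA addrC subrK.
rewrite -addrA -(bigD1 pr (P := mem (nu :|: B))) //= lerD2l.
rewrite (eq_bigl (fun q => (q \in nu) || (q \in B))); last by move=> q; rewrite inE.
rewrite bigU //=.
rewrite big1 ?add0r; last by move=> q /(fintype.subsetP nuZ); exact: yZ.
have sub0 (S S' : {set pos m n}) : S \subset S' -> \sum_(q in S) y q <= \sum_(q in S') y q.
  move=> /fintype.subsetP sSS; rewrite [leRHS](bigID (mem S)) /=.
  rewrite [X in _ <= X + _](eq_bigl (mem S)); first by rewrite lerDl sumr_ge0.
  by move=> q /=; case: (boolP (q \in S)) => [/sSS->|_]; rewrite ?andbT ?andbF.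
apply: le_trans (sub0 _ _ sB) _.
rewrite (bigID (mem A1)) /=.
rewrite [X in _ + X]big1 ?addr0; last first.
  by move=> q; rewrite inE andb_orl andbN /= => /andP[/(fintype.subsetP muZ) h _]; exact: yZ.
apply: le_trans (sub0 _ _ sA1).
rewrite le_eqVlt; apply/orP; left; apply/eqP; apply: eq_bigl => q.
by rewrite inE; case: (q \in A1); rewrite ?andbT ?andbF.
Qed.

End MinCover.

(** * Triangular matrices over a finite poset *)

Section ChainSums.
Context (F : fieldType) (I : finType).
Implicit Types (K W : I -> I -> F) (x y z : I).

Fixpoint kpow K l x y : F :=
  if l is l'.+1 then \sum_z K x z * kpow K l' z y else (x == y)%:R.

Lemma kpowSr K l x y : kpow K l.+1 x y = \sum_z kpow K l x z * K z y.
Proof.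
elim: l x => [|l IH] x.
  rewrite /= (bigD1 y) //= eqxx mulr1 big1 ?addr0; last first.
    by move=> z /negbTE ->; rewrite mulr0.
  rewrite (bigD1 x) //= eqxx mul1r big1 ?addr0 // => z.
  by rewrite eq_sym => /negbTE ->; rewrite mul0r.
rewrite [LHS]/=.
under eq_bigr do rewrite -/(kpow K l.+1 _ y) IH mulr_sumr.
rewrite exchange_big /=; apply: eq_bigr => z _.
by rewrite mulr_suml; apply: eq_bigr => u _; rewrite mulrA.
Qed.

Lemma kpow_transpose K l x y : kpow K l x y = kpow (fun u v => K v u) l y x.
Proof.
elim: l x y => [|l IH] x y; first by rewrite /= eq_sym.
by rewrite kpowSr /=; apply: eq_bigr => z _; rewrite IH mulrC.
Qed.

Lemma big_tuple_cons l (G : l.+1.-tuple I -> F) :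
  \sum_(c : l.+1.-tuple I) G c = \sum_x \sum_(c : l.-tuple I) G [tuple of x :: c].
Proof.
rewrite pair_big /= (reindex (fun p : I * l.-tuple I => [tuple of p.1 :: p.2])) //=.
exists (fun c : l.+1.-tuple I => (thead c, [tuple of behead c])).
  by case=> x c _ /=; congr pair; apply: val_inj.
by move=> c _ /=; apply: val_inj => /=; rewrite [in RHS](tuple_eta c).
Qed.

Lemma kpow_tuples K (d : I) l x y :
  \sum_(c : l.+1.-tuple I | (head d c == x) && (last d c == y))
     \prod_(i < l) K (nth d c i) (nth d c i.+1) = kpow K l x y.
Proof.
elim: l x => [|l IH] x.
  rewrite big_mkcond big_tuple_cons /=.
  rewrite (bigD1 x) //= [X in _ + X]big1 ?addr0; last first.
    by move=> u ux; rewrite big1 // => c _; rewrite (negbTE ux).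
  rewrite (bigD1 [tuple]) //= [X in _ + X]big1 ?addr0; last first.
    by move=> c /eqP[]; exact: tuple0.
  by rewrite eqxx big_ord0; case: (x == y).
rewrite big_mkcond big_tuple_cons (bigD1 x) //= [X in _ + X]big1 ?addr0; last first.
  by move=> u ux; rewrite big1 // => c _; rewrite (negbTE ux).
rewrite eqxx /= -big_mkcond /=.
rewrite (partition_big (fun c : l.+1.-tuple I => head d c) predT) //=.
apply: eq_bigr => z _; rewrite -IH mulr_sumr.
apply: eq_big => [c|c].
  rewrite andbC; congr (_ && _); by case: (tupleP c) => u s.
move=> /andP[_ /eqP <-]; rewrite big_ord_recl /=; congr (_ * _).
Qed.

Lemma prod_path (e : rel I) W d x s :
  \prod_(i < size s) (if e (nth d (x :: s) i) (nth d (x :: s) i.+1)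
                      then W (nth d (x :: s) i) (nth d (x :: s) i.+1) else 0) =
  if path e x s
  then \prod_(i < size s) W (nth d (x :: s) i) (nth d (x :: s) i.+1) else 0.
Proof.
elim: s x => [|y s IH] x; first by rewrite /= !big_ord0.
rewrite /= big_ord_recl /=.

rewrite (IH y) big_ord_recl /=; case: (e x y) => /=; last by rewrite mul0r.
case: (path e y s) => /=; last by rewrite mulr0.
by [].
Qed.

Lemma finset_mulC (Q : {set I}) (A B : I -> I -> F) :
  {in Q &, forall a b, \sum_(x in Q) B a x * A x b = (a == b)%:R} ->
  {in Q &, forall x y, \sum_(a in Q) A x a * B a y = (x == y)%:R}.
Proof.
move=> h x y xQ yQ.
pose MA := (\matrix_(i < #|Q|, j < #|Q|) A (enum_val i) (enum_val j)).
pose MB := (\matrix_(i < #|Q|, j < #|Q|) B (enum_val i) (enum_val j)).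
have BA : MB *m MA = 1%:M.
  apply/matrixP => i j; rewrite !mxE.
  rewrite -(inj_eq enum_val_inj) -h ?enum_valP // [RHS]big_enum_val.
  by apply: eq_bigr => u _; rewrite !mxE.
have /matrixP/(_ (enum_rank_in xQ x) (enum_rank_in xQ y)) := mulmx1C BA.
rewrite !mxE -(inj_eq enum_val_inj) !enum_rankK_in // => <-.
rewrite [LHS]big_enum_val; apply: eq_bigr => u _.
by rewrite !mxE !enum_rankK_in.
Qed.

End ChainSums.

Section Poset.
Context (F : fieldType) (I : finType) (Q : {set I}) (le : rel I).
Hypothesis le_refl : {in Q, forall x, le x x}.
Hypothesis le_anti : {in Q &, forall x y, le x y -> le y x -> x = y}.
Hypothesis le_trans : {in Q & &, forall y x z, le x y -> le y z -> le x z}.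
Implicit Types (W g : I -> I -> F) (x y z : I).

Definition strict W x y : F :=
  if [&& x \in Q, y \in Q & (x != y) && le x y] then W x y else 0.

Definition chain_sum W x y : F := \sum_(l < #|Q|) kpow (strict W) l x y.

Lemma kpow_height W l x y : x \in Q -> y \in Q -> kpow (strict W) l x y != 0 ->
  le x y /\ (l < #|[set z in Q | le x z]%SET|)%N.
Proof.
move=> + yQ; elim: l x => [|l IH] x xQ /=.
  have [->|] := eqVneq x y; last by rewrite eqxx.
  by rewrite le_refl // => _; split=> //; apply/card_gt0P; exists y; rewrite inE yQ le_refl.
move=> h; have /existsP[z] : [exists z, strict W x z * kpow (strict W) l z y != 0].
  apply: contraNT h; rewrite negb_exists => /forallP h.
  by apply/eqP/big1 => z _; apply/eqP; have := h z; rewrite negbK.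
rewrite mulf_eq0 negb_or /strict; case: ifP; last by rewrite eqxx.
case/and3P => _ zQ /andP[xz lxz] /andP[_ /(IH _ zQ)[lzy c]].
split; first exact: (le_trans zQ).
apply: leq_ltn_trans c (proper_card _); apply/properP; split.
  apply/fintype.subsetP => u; rewrite !inE => /andP[uQ zu]; rewrite uQ /=.
  exact: (le_trans zQ).
exists x; first by rewrite inE xQ le_refl.
rewrite inE xQ /=; apply/negP => zx; move/eqP: xz; apply; exact: le_anti.
Qed.

Lemma chain_sum_supp W x y : x \in Q -> y \in Q -> ~~ le x y -> chain_sum W x y = 0.
Proof.
move=> xQ yQ nxy; apply: big1 => l _; apply/eqP; apply: contraNT nxy.
by move=> /(kpow_height xQ yQ)[].
Qed.

Lemma chain_sum_rec W x y : x \in Q -> y \in Q ->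
  chain_sum W x y =
  (x == y)%:R + \sum_(z in Q | (x != z) && le x z) W x z * chain_sum W z y.
Proof.
move=> xQ yQ.
transitivity (\sum_(l < #|Q|.+1) kpow (strict W) l x y).
  rewrite big_ord_recr /=; apply/eqP; rewrite eq_sym addrC -subr_eq0 addrK.
  apply: contraT => /(kpow_height xQ yQ)[_]; rewrite ltnNge => /negP; case.
  by apply: subset_leq_card; apply/fintype.subsetP => z; rewrite inE => /andP[].
rewrite big_ord_recl /=; congr (_ + _).
rewrite exchange_big /= [RHS]big_mkcond; apply: eq_bigr => z _.
rewrite -mulr_sumr /strict xQ /=; case: ifP; last by rewrite mul0r.
by [].
Qed.

Lemma chain_sum_diag W x : x \in Q -> chain_sum W x x = 1.
Proof.
move=> xQ; rewrite chain_sum_rec // eqxx big1 ?addr0 // => z /andP[zQ /andP[xz lxz]].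
rewrite chain_sum_supp ?mulr0 //; apply: contra xz => lzx; apply/eqP; exact: le_anti.
Qed.

Lemma interval_D1 (G : I -> F) x : x \in Q ->
  \sum_(z in Q | le x z) G z = G x + \sum_(z in Q | (x != z) && le x z) G z.
Proof.
move=> xQ; rewrite (bigD1 x) ?xQ ?le_refl //=; congr (_ + _); apply: eq_bigl => z.
by rewrite -andbA eq_sym [(_ != _) && _]andbC.
Qed.

Lemma incidence_inverse_exists g :
  {in Q, forall x, g x x != 0} ->
  {in Q &, forall x y, ~~ le x y -> g x y = 0} ->
  exists h : I -> I -> F,
  [/\ {in Q &, forall x y, ~~ le x y -> h x y = 0},
      {in Q &, forall x y, \sum_(z in Q | le x z && le z y) g x z * h z y = (x == y)%:R}
    & {in Q &, forall x y, \sum_(z in Q | le x z && le z y) h x z * g z y = (x == y)%:R}].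
Proof.
move=> gd gs; pose W x z := - (g x z / g x x).
pose h x y := chain_sum W x y / g y y.
have hs : {in Q &, forall x y, ~~ le x y -> h x y = 0}.
  by move=> x y xQ yQ nxy; rewrite /h chain_sum_supp // mul0r.
have full (u v : I -> I -> F) : {in Q &, forall x y, ~~ le x y -> u x y = 0} ->
    {in Q &, forall x y, ~~ le x y -> v x y = 0} -> {in Q &, forall x y,
    \sum_(z in Q | le x z && le z y) u x z * v z y = \sum_(z in Q) u x z * v z y}.
  move=> us vs x y xQ yQ; rewrite big_mkcondr; apply: eq_bigr => z zQ.
  case: ifP => // /negbT; rewrite negb_and => /orP[] nle.
    by rewrite us // mul0r.
  by rewrite vs // mulr0.
have gh : {in Q &, forall x y, \sum_(z in Q) g x z * h z y = (x == y)%:R}.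
  move=> x y xQ yQ.
  have -> : \sum_(z in Q) g x z * h z y = \sum_(z in Q | le x z) g x z * h z y.
    rewrite [RHS]big_mkcondr; apply: eq_bigr => z zQ; case: ifP => // /negbT nle.
    by rewrite gs // mul0r.
  rewrite interval_D1 // /h chain_sum_rec //.
  under [X in _ + X]eq_bigr do rewrite mulrA.
  rewrite -mulr_suml.
  have -> : \sum_(z in Q | (x != z) && le x z) W x z * chain_sum W z y =
     - (\sum_(z in Q | (x != z) && le x z) g x z * chain_sum W z y) / g x x.
    rewrite -sumrN mulr_suml; apply: eq_bigr => z _; rewrite /W; ring.
  have gx := gd _ xQ; have gy := gd _ yQ.
  transitivity ((x == y)%:R * g x x / g y y); first by field; rewrite gx gy.
  by have [->|_] := eqVneq x y; rewrite ?mul0r // mul1r divff.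
exists h; split=> //.
  by move=> x y xQ yQ; rewrite full // gh.
by move=> x y xQ yQ; rewrite full // (finset_mulC gh).
Qed.

End Poset.

Section Eigenvectors.
Context (F : fieldType) (I : finType) (Q : {set I}) (le : rel I) (f : I -> I -> F).

Definition shifted_ratio rho x z : F :=
  - ((f x z - f rho rho) / (f x x - f rho rho)).

Definition right_vec rho x : F := chain_sum Q le (shifted_ratio rho) x rho.

Definition separated_below rho :=
  {in Q, forall x, x != rho -> le x rho -> f x x != f rho rho}.

Hypothesis le_refl : {in Q, forall x, le x x}.
Hypothesis le_anti : {in Q &, forall x y, le x y -> le y x -> x = y}.
Hypothesis le_trans : {in Q & &, forall y x z, le x y -> le y z -> le x z}.

Lemma right_vec_supp rho x : rho \in Q -> x \in Q -> ~~ le x rho -> right_vec rho x = 0.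
Proof. by move=> rQ xQ; exact: chain_sum_supp. Qed.

Lemma right_vec_diag rho : rho \in Q -> right_vec rho rho = 1.
Proof. by move=> rQ; rewrite /right_vec chain_sum_diag. Qed.

Lemma right_vec_eigen rho : rho \in Q -> separated_below rho ->
  {in Q, forall x, \sum_(z in Q | le x z) (f x z - f rho rho) * right_vec rho z = 0}.
Proof.
move=> rQ sep x xQ.
have [lxr|nlxr] := boolP (le x rho); last first.
  apply: big1 => z /andP[zQ lxz]; rewrite right_vec_supp ?mulr0 //.
  by apply: contra nlxr; exact: (le_trans zQ).
have [->|xr] := eqVneq x rho.
  rewrite (interval_D1 le_refl) // subrr mul0r add0r.
  apply: big1 => z /andP[zQ /andP[rz lrz]]; rewrite right_vec_supp ?mulr0 //.
  by apply: contra rz => lzr; apply/eqP; exact: le_anti.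
rewrite (interval_D1 le_refl) // {1}/right_vec chain_sum_rec // (negbTE xr) add0r.
rewrite mulr_sumr -big_split big1 //= => z _; rewrite /shifted_ratio -/(right_vec rho z).
have := sep x xQ xr lxr; rewrite -subr_eq0 => h.
by rewrite mulrA mulrN [(_ - _) * (_ / _)]mulrC divfK // mulNr addNr.
Qed.

Lemma right_vec_unique rho u : rho \in Q -> separated_below rho -> u rho = 1 ->
  {in Q, forall x, x != rho -> le x rho ->
     \sum_(z in Q | le x z && le z rho) (f x z - f rho rho) * u z = 0} ->
  {in Q, forall x, le x rho -> u x = right_vec rho x}.
Proof.
move=> rQ sep u1 hu x.
move: {2}#|_| (leqnn #|[set z in Q | le x z]%SET|) => N.
elim: N x => [|N IH] x hN xQ lxr.
  by move: hN; rewrite leqn0 cards_eq0 => /eqP/setP/(_ x); rewrite !inE xQ le_refl.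
have [->|xr] := eqVneq x rho; first by rewrite right_vec_diag.
have e1 := hu x xQ xr lxr.
have e2 : \sum_(z in Q | le x z && le z rho) (f x z - f rho rho) * right_vec rho z = 0.
  transitivity (\sum_(z in Q | le x z) (f x z - f rho rho) * right_vec rho z);
    last exact: right_vec_eigen.
  rewrite [RHS]big_mkcondr [LHS]big_mkcondr.
  apply: eq_bigr => z zQ; case: (le x z) => //=; case: ifP => // /negbT h.
  by rewrite right_vec_supp ?mulr0.
have P1 : (x \in Q) && (le x x && le x rho) by rewrite xQ le_refl ?lxr.
rewrite (bigD1 x) //= in e1; rewrite (bigD1 x) //= in e2.
have e3 : \sum_(z in Q | [&& le x z, le z rho & z != x]) (f x z - f rho rho) * u z =
   \sum_(z in Q | [&& le x z, le z rho & z != x]) (f x z - f rho rho) * right_vec rho z.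
  apply: eq_bigr => z /andP[zQ /and3P[lxz lzr zx]]; congr (_ * _); apply: IH => //.
  rewrite -ltnS; apply: leq_trans hN; apply: proper_card; apply/properP; split.
    apply/fintype.subsetP => v; rewrite !inE => /andP[vQ zv]; rewrite vQ /=.
    exact: (le_trans zQ).
  exists x; first by rewrite inE xQ le_refl.
  rewrite inE xQ /=; apply: contra zx => lzx; apply/eqP; exact: le_anti.
have := sep x xQ xr lxr; rewrite -subr_eq0 => h; apply: (mulfI h).
apply: (addIr (\sum_(z in Q | [&& le x z, le z rho & z != x]) (f x z - f rho rho) * u z)).
rewrite [X in _ = _ + X]e3.
under eq_bigl do rewrite andbA andbA -(andbA (_ \in _)).
rewrite e1; under eq_bigl do rewrite andbA andbA -(andbA (_ \in _)).
by rewrite e2.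
Qed.

End Eigenvectors.

Section Pencil.
Context (F : fieldType) (I : finType) (Q : {set I}) (le : rel I) (f : I -> I -> F).
Hypothesis le_refl : {in Q, forall x, le x x}.
Hypothesis le_anti : {in Q &, forall x y, le x y -> le y x -> x = y}.
Hypothesis le_trans : {in Q & &, forall y x z, le x y -> le y z -> le x z}.

Definition left_vec := right_vec Q (fun x y => le y x) (fun x y => f y x).

Let ge_anti : {in Q &, forall x y, le y x -> le x y -> x = y}.
Proof. by move=> x y xQ yQ h1 h2; exact: le_anti. Qed.

Let ge_trans : {in Q & &, forall y x z, le y x -> le z y -> le z x}.
Proof. by move=> y x z yQ xQ zQ h1 h2; exact: (le_trans yQ). Qed.

Hypothesis separated :
  {in Q &, forall x y, x != y -> le x y || le y x -> f x x != f y y}.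

Let sep_below rho : rho \in Q -> separated_below Q le f rho.
Proof. by move=> rQ x xQ xr l; apply: separated; rewrite ?l. Qed.

Let sep_above rho : rho \in Q ->
  separated_below Q (fun x y => le y x) (fun x y => f y x) rho.
Proof. by move=> rQ x xQ xr /= l; apply: separated; rewrite ?l ?orbT. Qed.

Notation R_ := (right_vec Q le f).
Notation L_ := left_vec.

(* F R_rho = f(rho,rho) zeta R_rho and L_sigma F = f(sigma,sigma) L_sigma zeta,
   so that L_sigma zeta R_rho vanishes unless the two eigenvalues agree. *)
Lemma biorthogonal : {in Q &, forall s r,
  \sum_(x in Q) L_ s x * (\sum_(z in Q | le x z) R_ r z) = (s == r)%:R}.
Proof.
move=> s r sQ rQ.
have [lsr|nlsr] := boolP (le s r); last first.
  have -> : (s == r) = false by apply: contraNF nlsr => /eqP ->; exact: le_refl.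
  apply: big1 => x xQ; have [lsx|nlsx] := boolP (le s x); last first.
    by rewrite /left_vec right_vec_supp ?mul0r.
  rewrite big1 ?mulr0 // => z /andP[zQ lxz]; rewrite right_vec_supp //.
  apply: contra nlsr => lzr; apply: (le_trans zQ) => //; exact: (le_trans xQ).
have [<-|sr] := eqVneq s r.
  rewrite (bigD1 s) //= [X in _ + X]big1 ?addr0.
    rewrite (bigD1 s) ?sQ ?le_refl //= [X in _ + X]big1 ?addr0.
      by rewrite /left_vec !right_vec_diag ?mulr1.
    move=> z /andP[/andP[zQ lsz] zs]; rewrite right_vec_supp //.
    apply: contra zs => lzs; apply/eqP; exact: le_anti.
  move=> x /andP[xQ xs]; have [lsx|nlsx] := boolP (le s x); last first.
    by rewrite /left_vec right_vec_supp ?mul0r.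
  rewrite big1 ?mulr0 // => z /andP[zQ lxz]; rewrite right_vec_supp //.
  apply: contra xs => lzs; apply/eqP; apply: le_anti => //; exact: (le_trans zQ).
have ne : f r r - f s s != 0.
  by rewrite subr_eq0; apply: separated; rewrite // 1?eq_sym // lsr orbT.
apply: (mulfI ne); rewrite mulr0.
have h1 : \sum_(x in Q) \sum_(z in Q | le x z) L_ s x * (f x z - f s s) * R_ r z = 0.
  transitivity (\sum_(z in Q) (\sum_(x in Q | le x z) (f x z - f s s) * L_ s x) * R_ r z).
    transitivity (\sum_(x in Q) \sum_(z in Q)
        if le x z then L_ s x * (f x z - f s s) * R_ r z else 0).
      by apply: eq_bigr => x _; rewrite big_mkcondr.
    rewrite exchange_big /=; apply: eq_bigr => z zQ.
    rewrite -big_mkcondr mulr_suml; apply: eq_bigr => x _.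
    by rewrite [L_ s x * _]mulrC.
  apply: big1 => z zQ.
  have -> := right_vec_eigen (le := fun x y => le y x) (f := fun x y => f y x)
       le_refl ge_anti ge_trans sQ (sep_above sQ) zQ.
  by rewrite mul0r.
have h2 : \sum_(x in Q) \sum_(z in Q | le x z) L_ s x * (f x z - f r r) * R_ r z = 0.
  apply: big1 => x xQ; transitivity (L_ s x * \sum_(z in Q | le x z) (f x z - f r r) * R_ r z).
    by rewrite mulr_sumr; apply: eq_bigr => z _; rewrite mulrA.
  by rewrite (right_vec_eigen le_refl le_anti le_trans rQ (sep_below rQ) xQ) mulr0.
transitivity (\sum_(x in Q) \sum_(z in Q | le x z) L_ s x * (f x z - f s s) * R_ r z -
   \sum_(x in Q) \sum_(z in Q | le x z) L_ s x * (f x z - f r r) * R_ r z); last first.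
  by rewrite h1 h2 subrr.
rewrite -sumrB mulr_sumr; apply: eq_bigr => x _.
rewrite -sumrB !mulr_sumr; apply: eq_bigr => z _; ring.
Qed.

Definition row_total r : F := \sum_(y in Q) L_ r y.

Lemma spectral_resolution : {in Q, forall x,
  \sum_(r in Q) (\sum_(z in Q | le x z) R_ r z) * row_total r = 1}.
Proof.
move=> x xQ.
have h := finset_mulC (A := fun x r => \sum_(z in Q | le x z) R_ r z) biorthogonal.
under eq_bigr do rewrite mulr_sumr.
rewrite exchange_big /=.
under eq_bigr => y yQ do rewrite (h x y xQ yQ).
rewrite (bigD1 x) //= eqxx big1 ?addr0 // => y /andP[_ yx].
by rewrite eq_sym (negbTE yx).
Qed.

Definition resolvent_total t y : F :=
  \sum_(r in Q) R_ r y * row_total r / (f r r + t).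

Lemma resolvent_totalP t : {in Q, forall r, f r r + t != 0} ->
  {in Q, forall x, \sum_(y in Q | le x y) (f x y + t) * resolvent_total t y = 1}.
Proof.
move=> nz x xQ; rewrite -(spectral_resolution xQ).
under eq_bigr do rewrite mulr_sumr.
rewrite exchange_big /=; apply: eq_bigr => r rQ.
have e := right_vec_eigen le_refl le_anti le_trans rQ (sep_below rQ) xQ.
transitivity ((\sum_(y in Q | le x y) (f x y - f r r) * R_ r y +
   (f r r + t) * \sum_(y in Q | le x y) R_ r y) * row_total r / (f r r + t)).
  rewrite [(f r r + t) * _]mulr_sumr -big_split /= !mulr_suml.
  by apply: eq_bigr => y _; ring.
rewrite e add0r; field; exact: nz.
Qed.

Lemma partial_fractions t x0 : {in Q, forall r, f r r + t != 0} ->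
  x0 \in Q -> {in Q, forall y, le x0 y} ->
  1 - t * \sum_(y in Q) resolvent_total t y =
  \sum_(r in Q) (\sum_(z in Q) R_ r z) * row_total r * (f r r / (f r r + t)).
Proof.
move=> nz x0Q x0min.
have tot (G : I -> F) : \sum_(z in Q) G z = \sum_(z in Q | le x0 z) G z.
  by apply: eq_bigl => z; case: (boolP (z \in Q)) => //= zQ; rewrite x0min.
rewrite -[X in X - _](spectral_resolution x0Q) exchange_big /= mulr_sumr -sumrB.
apply: eq_bigr => r rQ; rewrite -!mulr_suml tot; field; exact: nz.
Qed.

End Pencil.

Section StrictChains.
Context (F : fieldType) (I : finType) (Q : {set I}) (le : rel I).
Implicit Types (W : I -> I -> F).

Definition strict_chain (c : seq I) :=
  sorted (fun x y => (x != y) && le x y) c && all (mem Q) c.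

Lemma strict_chain_prod W (d : I) l (c : l.+1.-tuple I) :
  (head d c \in Q) || (last d c \in Q) ->
  \prod_(i < l) strict Q le W (nth d c i) (nth d c i.+1) =
  if strict_chain c then \prod_(i < l) W (nth d c i) (nth d c i.+1) else 0.
Proof.
case: (tupleP c) => x s /= hx.
have -> : strict_chain (x :: s) =
    path (fun x y => [&& x \in Q, y \in Q & (x != y) && le x y]) x s.
  rewrite /strict_chain /=; have [xQ|nxQ] := boolP (x \in Q).
    elim: (s : seq I) (x) xQ => [|y s' IH] z zQ //=; rewrite zQ /=.
    have [yQ|] := boolP (y \in Q); last by rewrite /= !andbF.
    by rewrite -(IH y yQ) /= andbA.
  rewrite andbF; move: hx; rewrite (negbTE nxQ) /=.
  by case: (s : seq I) => [|y s' _] /=; rewrite (negbTE nxQ).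
have := prod_path (fun x y => [&& x \in Q, y \in Q & (x != y) && le x y]) W d x s.
by rewrite size_tuple.
Qed.

Lemma chain_sum_outside W x y : x \notin Q -> y \in Q -> chain_sum Q le W x y = 0.
Proof.
move=> nx yQ; apply: big1 => -[[|l] ?] _ /=.
  by case: eqP => // e; rewrite e yQ in nx.
by apply: big1 => z _; rewrite /strict (negbTE nx) mul0r.
Qed.

Lemma chain_sum_outside_r W x y : x \in Q -> y \notin Q -> chain_sum Q le W x y = 0.
Proof.
move=> xQ ny; apply: big1 => -[[|l] ?] _.
  by rewrite /=; case: eqP => // e; rewrite -e xQ in ny.
by rewrite kpowSr; apply: big1 => z _; rewrite /strict (negbTE ny) andbF mulr0.
Qed.

Lemma chains_to W (d : I) S : S \in Q ->
  \sum_(l < #|Q|) \sum_(c : l.+1.-tuple I | strict_chain c && (last d c == S))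
     \prod_(i < l) W (nth d c i) (nth d c i.+1) = \sum_(x in Q) chain_sum Q le W x S.
Proof.
move=> SQ; transitivity (\sum_x chain_sum Q le W x S); last first.
  rewrite (bigID (mem Q)) /= [X in _ + X]big1 ?addr0 // => x nx.
  exact: chain_sum_outside.
rewrite exchange_big /=; apply: eq_bigr => l _.
transitivity (\sum_x \sum_(c : l.+1.-tuple I | (head d c == x) && (last d c == S))
   \prod_(i < l) strict Q le W (nth d c i) (nth d c i.+1)); last first.
  by apply: eq_bigr => x _; rewrite kpow_tuples.
transitivity (\sum_(c : l.+1.-tuple I | last d c == S)
   \prod_(i < l) strict Q le W (nth d c i) (nth d c i.+1)).
  rewrite big_mkcondl; apply: eq_bigr => c /eqP e.
  by rewrite strict_chain_prod // e SQ orbT.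
rewrite (partition_big (fun c : l.+1.-tuple I => head d c) predT) //=.
by apply: eq_bigr => x _; apply: eq_bigl => c; rewrite andbC.
Qed.

Lemma chains_from W (d : I) S : S \in Q ->
  \sum_(l < #|Q|) \sum_(c : l.+1.-tuple I | strict_chain c && (head d c == S))
     \prod_(i < l) W (nth d c i) (nth d c i.+1) = \sum_(y in Q) chain_sum Q le W S y.
Proof.
move=> SQ; transitivity (\sum_y chain_sum Q le W S y); last first.
  rewrite (bigID (mem Q)) /= [X in _ + X]big1 ?addr0 // => x nx.
  exact: chain_sum_outside_r.
rewrite exchange_big /=; apply: eq_bigr => l _.
transitivity (\sum_x \sum_(c : l.+1.-tuple I | (head d c == S) && (last d c == x))
   \prod_(i < l) strict Q le W (nth d c i) (nth d c i.+1)); last first.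
  by apply: eq_bigr => x _; rewrite kpow_tuples.
transitivity (\sum_(c : l.+1.-tuple I | head d c == S)
   \prod_(i < l) strict Q le W (nth d c i) (nth d c i.+1)).
  rewrite big_mkcondl; apply: eq_bigr => c /eqP e.
  by rewrite strict_chain_prod // e SQ.
by rewrite (partition_big (fun c : l.+1.-tuple I => last d c) predT).
Qed.

Lemma chain_sum_transpose W x y :
  chain_sum Q le W x y = chain_sum Q (fun u v => le v u) (fun u v => W v u) y x.
Proof.
apply: eq_bigr => l _; rewrite kpow_transpose.
elim: (l : nat) (y) => [//|l' IH] z /=; apply: eq_bigr => u _; rewrite IH; congr (_ * _).
by rewrite /strict eq_sym andbCA.
Qed.

End StrictChains.

(** * Critical rectangles and the recursion for the Laplace transform *)

Section CriticalRectangles.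
Context (m n k : nat).
Hypotheses (k_gt0 : (0 < k)%N) (k_le : (k <= minn m n)%N).
Implicit Types (Z : {set pos m n}) (al be : lines m n) (S : rectangle m n).

Lemma uncovered_line al : lsize al = k.-1 ->
  (exists u, u \notin al.1) /\ (exists v, v \notin al.2).
Proof.
move=> s; split.
  have [/eqP h|h] := boolP (al.1 == finset.setT).
    move: s k_gt0 k_le; rewrite /lsize h cardsT card_ord; lia.
  have [i _ ni] : exists2 i : 'I_m, i \in [set: 'I_m]%SET & i \notin al.1.
    by apply/subsetPn; rewrite finset.subTset.
  by exists i.
have [/eqP h|h] := boolP (al.2 == finset.setT).
  move: s k_gt0 k_le; rewrite /lsize h cardsT card_ord; lia.
have [i _ ni] : exists2 i : 'I_n, i \in [set: 'I_n]%SET & i \notin al.2.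
  by apply/subsetPn; rewrite finset.subTset.
by exists i.
Qed.

Lemma rect_of_sub al be : lsize al = k.-1 -> rect_of al \subset rect_of be ->
  be.1 \subset al.1 /\ be.2 \subset al.2.
Proof.
move=> sal /fintype.subsetP h; have [[u0 nu0] [v0 nv0]] := uncovered_line sal.
split; apply/fintype.subsetP => w; apply: contraLR => nw.
  by have := h (w, v0); rewrite !inE /covered /= !negb_or nw nv0 => /(_ isT)/andP[].
by have := h (u0, w); rewrite !inE /covered /= !negb_or nw nu0 => /(_ isT)/andP[].
Qed.

Lemma is_cover_lsize Z al : is_cover k.-1 Z al -> lsize al = k.-1.
Proof. by rewrite is_coverE => /andP[/eqP]. Qed.

Lemma rect_of_inj Z Z' al be : is_cover k.-1 Z al -> is_cover k.-1 Z' be ->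
  rect_of al = rect_of be -> al = be.
Proof.
move=> /is_cover_lsize ha /is_cover_lsize hb e.
have [a1 a2] : be.1 \subset al.1 /\ be.2 \subset al.2 by apply: rect_of_sub; rewrite ?e.
have [b1 b2] : al.1 \subset be.1 /\ al.2 \subset be.2 by apply: rect_of_sub; rewrite ?e.
case: al be {ha hb e} a1 a2 b1 b2 => [a b] [c d'] /= a1 a2 b1 b2.
by congr (_, _); apply/eqP; rewrite finset.eqEsubset ?a1 ?a2 ?b1 ?b2.
Qed.

Lemma criticalP Z S :
  reflect (exists2 al, is_cover k.-1 Z al & S = rect_of al) (S \in critical k Z).
Proof. by apply: (iffP imsetP) => -[al h e]; exists al. Qed.

Lemma rect_of_critical Z al : is_cover k.-1 Z al -> rect_of al \in critical k Z.
Proof. by move=> c; apply/criticalP; exists al. Qed.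

Lemma rect_le_of Z al be : is_cover k.-1 Z al -> is_cover k.-1 Z be ->
  rect_le k Z (rect_of al) (rect_of be) = (al.2 \subset be.2) && (be.1 \subset al.1).
Proof.
move=> ha hb; apply/existsP/idP => [[al' /existsP[be' /and5P[ha' hb' /eqP ea /eqP eb]]]|h].
  by rewrite (rect_of_inj ha ha' ea) (rect_of_inj hb hb' eb).
by exists al; apply/existsP; exists be; rewrite ha hb !eqxx.
Qed.

Lemma rect_le_critical Z S S' : rect_le k Z S S' ->
  S \in critical k Z /\ S' \in critical k Z.
Proof.
by case/existsP => al /existsP[be /and5P[ha hb /eqP -> /eqP -> _]]; split; exact: rect_of_critical.
Qed.

Lemma rect_le_refl Z : {in critical k Z, forall S, rect_le k Z S S}.
Proof. by move=> S /criticalP[al c ->]; rewrite rect_le_of // !subxx. Qed.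

Lemma rect_le_anti Z : {in critical k Z &, forall S S',
  rect_le k Z S S' -> rect_le k Z S' S -> S = S'}.
Proof.
move=> S S' /criticalP[al ha ->] /criticalP[be hb ->].
rewrite !rect_le_of // => /andP[a1 a2] /andP[b1 b2]; congr rect_of.
case: al be {ha hb} a1 a2 b1 b2 => [a b] [c d'] /= a1 a2 b1 b2.
by congr (_, _); apply/eqP; rewrite finset.eqEsubset ?a1 ?a2 ?b1 ?b2.
Qed.

Lemma rect_le_trans Z : {in critical k Z & &, forall S2 S1 S3,
  rect_le k Z S1 S2 -> rect_le k Z S2 S3 -> rect_le k Z S1 S3}.
Proof.
move=> S S' S'' /criticalP[al ha ->] /criticalP[be hb ->] /criticalP[ga hc ->].
rewrite !rect_le_of // => /andP[a1 a2] /andP[b1 b2].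
by rewrite (fintype.subset_trans a1 b1) (fintype.subset_trans b2 a2).
Qed.

Lemma rect_disjoint Z S p : S \in critical k Z -> p \in S -> p \notin Z.
Proof.
move=> /criticalP[al]; rewrite is_coverE => /andP[_ /coversP c] ->.
by rewrite inE; apply: contra; exact: c.
Qed.

Lemma critical_neq0 Z S : S \in critical k Z -> S != finset.set0.
Proof.
move=> /criticalP[al /is_cover_lsize/uncovered_line[[u nu] [v nv]] ->].
by apply/set0Pn; exists (u, v); rewrite inE /covered negb_or nu.
Qed.

Lemma critical_setU1 Z p : critical k (p |: Z) = [set S in critical k Z | p \notin S]%SET.
Proof.
have cU al : is_cover k.-1 (p |: Z) al = is_cover k.-1 Z al && covered al p.
  rewrite !is_coverE -andbA; congr (_ && _); apply/coversP/andP => [h|[/coversP h h'] q].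
    split; last by apply: h; rewrite setU11.
    by apply/coversP => q qZ; apply: h; rewrite inE qZ orbT.
  by rewrite !inE => /orP[/eqP->|/h].
apply/setP => S; rewrite inE; apply/criticalP/andP => [[al + ->]|[/criticalP[al ca ->]]].
  by rewrite cU => /andP[c cp]; split; [exact: rect_of_critical|rewrite inE cp].
by rewrite inE negbK => cp; exists al => //; rewrite cU ca.
Qed.

Lemma minimum_cover_le Z Z' al S : Z \subset Z' -> minimum_cover k Z' al ->
  S \in critical k Z' -> rect_le k Z (rect_of al) S.
Proof.
move=> /fintype.subsetP sZ [ca h] /criticalP[be cb ->].
have sub ga : is_cover k.-1 Z' ga -> is_cover k.-1 Z ga.
  rewrite !is_coverE => /andP[-> /coversP c]; apply/coversP => p /sZ; exact: c.
by rewrite rect_le_of ?sub //; have [-> ->] := h _ cb.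
Qed.

Definition critical_upset Z Z' :=
  forall S S', S \in critical k Z' -> rect_le k Z S S' -> S' \in critical k Z'.

Lemma critical_upset_refl Z : critical_upset Z Z.
Proof. by move=> S S' _ /rect_le_critical[]. Qed.

Lemma critical_upset_setU1 Z Z' al p : Z \subset Z' -> critical_upset Z Z' ->
  minimum_cover k Z' al -> p \in rect_of al -> critical_upset Z (p |: Z').
Proof.
move=> sZ up mal pal S S'; rewrite critical_setU1 !inE => /andP[SQ pS] lSS'.
have S'Q := up S S' SQ lSS'; rewrite S'Q /=.
have la := minimum_cover_le sZ mal SQ.
have [/criticalP[ga cg eS] /criticalP[be cb eS']] := rect_le_critical lSS'.
have cal : is_cover k.-1 Z al.
  have := mal.1; rewrite !is_coverE => /andP[-> /coversP c].
  by apply/coversP => q /(fintype.subsetP sZ); exact: c.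
move: la lSS' pS pal; rewrite eS eS' !rect_le_of // !inE !negbK /covered negb_or.
move=> /andP[_ /fintype.subsetP g1] /andP[/fintype.subsetP g2 _] /orP[/g1 ->//|/g2 ->].
by rewrite orbT.
Qed.

Lemma independent_zeros_sub Z Z' : Z \subset Z' ->
  independent_zeros k Z -> independent_zeros k Z'.
Proof. by move=> sZ [A Ak AZ]; exists A => //; exact: fintype.subset_trans sZ. Qed.

Lemma critical_minimum_cover Z : independent_zeros k Z -> critical k Z != finset.set0 ->
  exists al, minimum_cover k Z al.
Proof. by move=> iZ /set0Pn[S /criticalP[al c _]]; exact: minimum_cover_exists iZ c. Qed.

Lemma critical0_zeros Z : independent_zeros k Z -> critical k Z = finset.set0 ->
  exists2 A, A \in assignments m n k & A \subset Z.
Proof.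
move=> iZ Q0; apply: konig => al c.
have := covers_lsize iZ c; rewrite leq_eqVlt => /orP[/eqP e|]; last by rewrite prednK.
have : rect_of al \in critical k Z by apply: rect_of_critical; rewrite is_coverE -e eqxx.
by rewrite Q0 inE.
Qed.

End CriticalRectangles.

Section Coefficients.
Context (R : realType) (m n k : nat).
Hypotheses (k_gt0 : (0 < k)%N) (k_le : (k <= minn m n)%N).
Implicit Types (Z : {set pos m n}) (rate : pos m n -> R) (S : rectangle m n).

Definition overlap rate (S S' : rectangle m n) : R := rect_rate rate (S :&: S').

Lemma overlapxx rate S : overlap rate S S = rect_rate rate S.
Proof. by rewrite /overlap finset.setIid. Qed.

Lemma overlapC rate S S' : overlap rate S S' = overlap rate S' S.
Proof. by rewrite /overlap finset.setIC. Qed.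

Notation Rv Z rate := (right_vec (critical k Z) (rect_le k Z) (overlap rate)).
Notation Lv Z rate := (left_vec (critical k Z) (rect_le k Z) (overlap rate)).

Lemma coef_a_right_vec Z rate S : S \in critical k Z ->
  coef_a k Z rate S = - \sum_(x in critical k Z) Rv Z rate S x.
Proof.
move=> SQ; rewrite -(chains_to _ _ finset.set0 SQ) -sumrN.
apply: eq_bigr => l _; rewrite -[RHS]sumrN; apply: eq_big => [//|c _].
rewrite prodrN card_ord exprS mulN1r mulNr; congr (- (_ * _)).
by apply: eq_bigr => i _; rewrite !overlapxx.
Qed.

Lemma coef_b_left_vec Z rate S : S \in critical k Z ->
  coef_b k Z rate S = - row_total (critical k Z) (rect_le k Z) (overlap rate) S.
Proof.
move=> SQ; rewrite /row_total /left_vec /right_vec.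
under eq_bigr do rewrite chain_sum_transpose.
rewrite -(chains_from _ _ finset.set0 SQ) -sumrN.
apply: eq_bigr => l _; rewrite -[RHS]sumrN; apply: eq_big => [//|c _].
rewrite prodrN card_ord exprS mulN1r mulNr; congr (- (_ * _)).
by apply: eq_bigr => i _; rewrite !overlapxx overlapC.
Qed.

Lemma coef_cE Z rate S : S \in critical k Z ->
  coef_c k Z rate S = (\sum_(x in critical k Z) Rv Z rate S x) *
                      (\sum_(y in critical k Z) Lv Z rate S y).
Proof. by move=> SQ; rewrite /coef_c coef_a_right_vec // coef_b_left_vec // mulrNN. Qed.

Lemma rect_rate_gt0 Z rate S : (forall p, p \notin Z -> 0 < rate p) ->
  S \in critical k Z -> 0 < rect_rate rate S.
Proof.
move=> pos SQ; have /set0Pn[p pS] := critical_neq0 k_gt0 k_le SQ.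
rewrite /rect_rate (bigD1 p) //= ltr_wpDr //; last by apply/pos/(rect_disjoint SQ).
by apply: sumr_ge0 => q /andP[qS _]; apply/ltW/pos/(rect_disjoint SQ).
Qed.

Lemma generic_at_separated Z rate S : S \in critical k Z -> generic_at k Z rate S ->
  {in critical k Z, forall x, x != S -> rect_le k Z x S || rect_le k Z S x ->
     overlap rate x x != overlap rate S S}.
Proof.
move=> SQ gen x xQ xS h; rewrite !overlapxx eq_sym; apply/eqP; apply: gen => //.
exact/orP.
Qed.

Lemma in_comparable Z S x : x \in critical k Z ->
  (x \in rect_comparable k Z S) = rect_le k Z x S || rect_le k Z S x.
Proof. by move=> xQ; rewrite inE xQ. Qed.

Lemma comparable_sub Z S : rect_comparable k Z S \subset critical k Z.
Proof. by apply/fintype.subsetP => x; rewrite inE => /andP[]. Qed.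

Lemma g_fun_le Z rate S x y : (x != S) || (y != S) -> rect_le k Z x y ->
  g_fun k Z rate S x y = overlap rate x y - overlap rate S S.
Proof. by move=> h l; rewrite /g_fun l overlapxx; case: eqP h => //= _; case: eqP. Qed.

Lemma g_fun_inverse_exists Z rate S : S \in critical k Z -> generic_at k Z rate S ->
  exists h, incidence_inverse (rect_comparable k Z S) (rect_le k Z) (g_fun k Z rate S) h.
Proof.
move=> SQ gen; set Q' := rect_comparable k Z S.
have sQ x : x \in Q' -> x \in critical k Z by move/(fintype.subsetP (comparable_sub _ _)).
have refl : {in Q', forall x, rect_le k Z x x} by move=> x /sQ; exact: rect_le_refl.
have anti : {in Q' &, forall x y, rect_le k Z x y -> rect_le k Z y x -> x = y}.
  by move=> x y /sQ xQ /sQ yQ; exact: (rect_le_anti k_gt0 k_le).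
have trans : {in Q' & &, forall y x z,
    rect_le k Z x y -> rect_le k Z y z -> rect_le k Z x z}.
  by move=> x y z /sQ xQ /sQ yQ /sQ zQ; exact: (rect_le_trans k_gt0 k_le).
have [||h [h1 h2 h3]] := incidence_inverse_exists refl anti trans (g := g_fun k Z rate S).
- move=> x xQ'; have xQ := sQ x xQ'; have [->|xS] := eqVneq x S.
    by rewrite /g_fun eqxx oner_neq0.
  rewrite g_fun_le ?xS ?(rect_le_refl k_gt0 k_le) // subr_eq0.
  apply: (generic_at_separated SQ gen) => //; by move: xQ'; rewrite in_comparable.
- move=> x y xQ yQ nle; rewrite /g_fun nle; case: ifP => // /andP[/eqP ex /eqP ey].
  by move: nle; rewrite ex ey (rect_le_refl k_gt0 k_le).
by exists h; split; [exact: h1|exact: h2|exact: h3].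
Qed.

Lemma coef_c_g_inverse Z rate S (Q' : {set rectangle m n}) h :
  S \in critical k Z -> generic_at k Z rate S ->
  rect_comparable k Z S \subset Q' -> Q' \subset critical k Z ->
  incidence_inverse Q' (rect_le k Z) (g_fun k Z rate S) h ->
  coef_c k Z rate S =
    (\sum_(S' in critical k Z | rect_le k Z S' S) h S' S) *
    (\sum_(S' in critical k Z | rect_le k Z S S') h S S').
Proof.
move=> SQ gen /fintype.subsetP cQ' /fintype.subsetP Q'Q [h1 h2 h3].
have refl := rect_le_refl k_gt0 k_le (Z := Z).
have anti := rect_le_anti k_gt0 k_le (Z := Z).
have trans := rect_le_trans k_gt0 k_le (Z := Z).
have anti' : {in critical k Z &, forall x y,
    rect_le k Z y x -> rect_le k Z x y -> x = y}.
  by move=> x y xQ yQ l1 l2; exact: anti.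
have trans' : {in critical k Z & &, forall y x z,
    rect_le k Z y x -> rect_le k Z z y -> rect_le k Z z x}.
  by move=> y x z yQ xQ zQ l1 l2; exact: (trans y).
have SQ' : S \in Q' by apply: cQ'; rewrite in_comparable // refl.
have interval x y (G : rectangle m n -> R) : x = S \/ y = S ->
    \sum_(z in Q' | rect_le k Z x z && rect_le k Z z y) G z =
    \sum_(z in critical k Z | rect_le k Z x z && rect_le k Z z y) G z.
  move=> exy; apply: eq_bigl => z; apply: andb_id2r => /andP[lxz lzy].
  apply/idP/idP => [/Q'Q //|zQ]; apply: cQ'; rewrite in_comparable //.
  by case: exy => <-; rewrite ?lxz ?lzy ?orbT.
have single (G : rectangle m n -> R) :
    \sum_(z in critical k Z | rect_le k Z S z && rect_le k Z z S) G z = G S.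
  rewrite (bigD1 S) /=; last by rewrite SQ refl.
  rewrite big1 ?addr0 // => z /andP[/andP[zQ /andP[l1 l2]] zS].
  by case/eqP: zS; exact: anti.
have hSS : h S S = 1.
  have := h2 S S SQ' SQ'; rewrite /incidence_mul interval; last by left.
  by rewrite single eqxx /g_fun eqxx mul1r.
rewrite coef_cE //; congr (_ * _).
  rewrite [RHS]big_mkcondr; apply: eq_bigr => x xQ; case: ifP => [lxS|/negbT nle]; last first.
    exact: (right_vec_supp (overlap rate) refl anti trans).
  symmetry; apply: (right_vec_unique (u := fun x => h x S) refl anti trans) => //.
    by move=> y yQ yS l; apply: (generic_at_separated SQ gen) => //; rewrite l.
  move=> y yQ yS lyS.
  have yQ' : y \in Q' by apply: cQ'; rewrite in_comparable // lyS.
  have := h2 y S yQ' SQ'; rewrite /incidence_mul (negbTE yS) interval; last by right.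
  move=> e; apply: etrans e; apply: eq_bigr => z /andP[_ /andP[lyz _]].
  by rewrite g_fun_le // yS.
rewrite [RHS]big_mkcondr; apply: eq_bigr => x xQ; case: ifP => [lSx|/negbT nle]; last first.
  exact: (right_vec_supp (le := fun x y => rect_le k Z y x) _ refl anti' trans').
symmetry; rewrite /left_vec; apply: (right_vec_unique (le := fun x y => rect_le k Z y x)
  (f := fun x y => overlap rate y x) (u := fun x => h S x) refl anti' trans') => //.
- by move=> y yQ yS /= l; apply: (generic_at_separated SQ gen) => //; rewrite l orbT.
move=> y yQ yS /= lSy.
have yQ' : y \in Q' by apply: cQ'; rewrite in_comparable // lSy orbT.
have := h3 S y SQ' yQ'; rewrite /incidence_mul eq_sym (negbTE yS) interval; last by left.
move=> e; apply: etrans e; apply: eq_big => [z|z]; first by rewrite [rect_le k Z z y && _]andbC.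
by move=> /andP[_ /andP[lzy _]]; rewrite mulrC g_fun_le // yS orbT.
Qed.

(* Each step explores the minimum critical rectangle: the position at which its
   smallest entry sits becomes a new zero. The first argument bounds the number
   of steps. *)
Fixpoint growth_laplace N rate (t : R) Z : R :=
  if N is N'.+1 then
    if [pick al | `[< minimum_cover k Z al >]] is Some al then
      \sum_(p in rect_of al)
        rate p / (rect_rate rate (rect_of al) + t) * growth_laplace N' rate t (p |: Z)
    else 1
  else 1.

Lemma growth_laplace_resolvent N rate t Z Z' :
  (forall p, p \notin Z -> 0 < rate p) -> generic k Z rate -> 0 <= t ->
  independent_zeros k Z -> Z \subset Z' -> critical_upset k Z Z' ->
  (#|~: Z'| < N)%N ->
  growth_laplace N rate t Z' =
  1 - t * \sum_(y in critical k Z')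
            resolvent_total (critical k Z) (rect_le k Z) (overlap rate) t y.
Proof.
move=> pos gen t0 iZ; elim: N Z' => // N IH Z' sZ up hN /=.
have iZ' := independent_zeros_sub sZ iZ.
case: pickP => [al /asboolP mal|none]; last first.
  suff -> : critical k Z' = finset.set0 by rewrite big_set0 mulr0 subr0.
  apply/eqP; apply: contraT => /(critical_minimum_cover iZ')[al mal].
  by have := none al; rewrite asboolT.
set S0 := rect_of al; set v := resolvent_total _ _ _ _; set I0 := rect_rate rate S0.
have SQ' : S0 \in critical k Z' by apply: rect_of_critical; exact: mal.1.
have SQ : S0 \in critical k Z.
  by have := minimum_cover_le k_gt0 k_le sZ mal SQ' => /rect_le_critical[].
have posI := rect_rate_gt0 pos.
have step p : p \in S0 -> growth_laplace N rate t (p |: Z') =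
    1 - t * \sum_(y in critical k Z' | p \notin y) v y.
  move=> pS; rewrite IH.
  - congr (_ - _ * _); apply: eq_bigl => y; by rewrite critical_setU1 inE.
  - by apply: fintype.subset_trans sZ _; exact: finset.subsetUr.
  - exact: (critical_upset_setU1 k_gt0 k_le sZ up mal).
  - rewrite -ltnS; apply: leq_trans hN; apply: proper_card; apply/properP; split.
      by apply/fintype.subsetP => q; rewrite !inE negb_or => /andP[].
    by exists p; rewrite !inE ?eqxx // (rect_disjoint SQ').
have eqn : \sum_(y in critical k Z') (overlap rate S0 y + t) * v y = 1.
  rewrite -[RHS](@resolvent_totalP _ _ (critical k Z) (rect_le k Z) (overlap rate)
     (rect_le_refl k_gt0 k_le (Z := Z)) (rect_le_anti k_gt0 k_le (Z := Z))
     (rect_le_trans k_gt0 k_le (Z := Z)) _ t _ S0 SQ).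
  - apply: eq_bigl => y; apply/idP/andP => [yQ|[_ l]]; last exact: up SQ' l.
    have l := minimum_cover_le k_gt0 k_le sZ mal yQ.
    by split=> //; have [] := rect_le_critical l.
  - by move=> x y xQ yQ xy l; exact: (generic_at_separated yQ (gen _ yQ)).
  - by move=> r rQ; rewrite overlapxx gt_eqF // ltr_wpDr // posI.
have I0t : I0 + t != 0 by rewrite gt_eqF // ltr_wpDr // posI.
have swap : \sum_(p in S0) rate p * \sum_(y in critical k Z' | p \notin y) v y =
    \sum_(y in critical k Z') (I0 - overlap rate S0 y) * v y.
  transitivity (\sum_(p in S0) \sum_(y in critical k Z')
     if p \notin y then rate p * v y else 0).
    by apply: eq_bigr => p _; rewrite mulr_sumr big_mkcondr.
  rewrite exchange_big /=; apply: eq_bigr => y _.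
  rewrite -big_mkcondr -mulr_suml; congr (_ * _); apply/eqP; rewrite eq_sym subr_eq; apply/eqP.
  rewrite /I0 /rect_rate (bigID (mem y)) /= addrC; congr (_ + _).
  by rewrite /overlap /rect_rate; apply: eq_bigl => q; rewrite finset.in_setI.
apply: (mulfI I0t).
transitivity (\sum_(p in S0) rate p -
    t * \sum_(p in S0) rate p * \sum_(y in critical k Z' | p \notin y) v y).
  rewrite mulr_sumr mulr_sumr -sumrB; apply: eq_bigr => p pS; rewrite step //; by field.
rewrite swap -/(rect_rate rate S0) -/I0.
have -> : \sum_(y in critical k Z') (I0 - overlap rate S0 y) * v y =
    (I0 + t) * (\sum_(y in critical k Z') v y) - 1.
  rewrite -eqn mulr_sumr -sumrB; apply: eq_bigr => y _; ring.
ring.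
Qed.

Lemma growth_laplace_coef_c N rate t Z :
  (forall p, p \notin Z -> 0 < rate p) -> generic k Z rate -> 0 <= t ->
  independent_zeros k Z -> critical k Z != finset.set0 -> (#|~: Z| < N)%N ->
  growth_laplace N rate t Z =
  \sum_(S in critical k Z)
     coef_c k Z rate S * (rect_rate rate S / (rect_rate rate S + t)).
Proof.
move=> pos gen t0 iZ Q0 hN.
rewrite (@growth_laplace_resolvent N rate t Z Z) //; last exact: critical_upset_refl.
have [al mal] := critical_minimum_cover iZ Q0.
have SQ : rect_of al \in critical k Z by apply: rect_of_critical; exact: mal.1.
rewrite (@partial_fractions _ _ _ _ _
     (rect_le_refl k_gt0 k_le (Z := Z)) (rect_le_anti k_gt0 k_le (Z := Z))
     (rect_le_trans k_gt0 k_le (Z := Z)) _ t (rect_of al)) //.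
- by apply: eq_bigr => S SQ'; rewrite coef_cE // overlapxx.
- by move=> x y xQ yQ xy l; exact: (generic_at_separated yQ (gen _ yQ)).
- by move=> r rQ; rewrite overlapxx gt_eqF // ltr_wpDr // (rect_rate_gt0 pos).
- by move=> y yQ; exact: (minimum_cover_le k_gt0 k_le (subxx Z) mal yQ).
Qed.

Lemma growth_laplace_cvg N (r : nat -> pos m n -> R) rate t Z :
  (forall p, p \notin Z -> 0 < rate p) -> 0 <= t ->
  (forall p, p \notin Z -> ((fun j => r j p) @ \oo --> rate p)%classic) ->
  ((fun j => growth_laplace N (r j) t Z) @ \oo --> growth_laplace N rate t Z)%classic.
Proof.
move=> + t0; elim: N Z => [|N IH] Z pos hr /=; first exact: cvg_cst.
case: pickP => [al /asboolP mal|_]; last exact: cvg_cst.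
have SQ : rect_of al \in critical k Z by apply: rect_of_critical; exact: mal.1.
apply: cvg_big => [|p pS]; first exact: add_continuous.
apply: cvgM; last first.
  by apply: IH => q; rewrite !inE negb_or => /andP[_ qZ]; [exact: pos|exact: hr].
apply: cvgM; first by apply: hr; exact: (rect_disjoint SQ pS).
apply: cvgV; first by rewrite gt_eqF // ltr_wpDr // (rect_rate_gt0 pos).
apply: cvgD; last exact: cvg_cst.
apply: cvg_big => [|q qS]; first exact: add_continuous.
by apply: hr; exact: (rect_disjoint SQ qS).
Qed.

End Coefficients.

Local Open Scope classical_set_scope.

(** * Independent exponential variables *)

Section MeasurableForall.
Context d (T : measurableType d) (I : finType).

Lemma measurable_forall (A : I -> set T) :
  (forall i, measurable (A i)) -> measurable [set w | forall i, A i w].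
Proof.
move=> mA; have -> : [set w | forall i, A i w] = \bigcap_(i in [set: I]) A i.
  by apply/seteqP; split => w h i //; exact: h.
by apply: fin_bigcap_measurable => //; exact: finite_finset.
Qed.

Lemma measurable_forall_in (D : {set I}) (A : I -> set T) :
  (forall i, i \in D -> measurable (A i)) ->
  measurable [set w | forall i, i \in D -> A i w].
Proof.
move=> mA; apply: (measurable_forall (A := fun i => [set w | i \in D -> A i w])) => i.
have [iD|niD] := boolP (i \in D).
  rewrite (_ : [set w | _ ] = A i); first exact: mA.
  by apply/seteqP; split=> [w /= h|w h _]; [exact: h|exact: h].
by rewrite (_ : [set w | _ ] = setT) //; apply/seteqP; split.
Qed.

End MeasurableForall.

Section Boxes.
Context (R : realType) (I : finType).
Implicit Types (b : I -> R) (p q : I).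

Definition box b : set (I -> R) := [set x | forall q, b q < x q].

Definition boxes : set (set (I -> R)) := range box.

Notation V := (g_sigma_algebraType boxes).

Lemma boxes_setI : setI_closed boxes.
Proof.
move=> _ _ [b _ <-] [c _ <-]; exists (fun q => Num.max (b q) (c q)) => //.
apply/seteqP; split => x /=.
  by move=> h; split => q; have := h q; rewrite gt_max => /andP[].
by move=> [h1 h2] q; rewrite gt_max h1 h2.
Qed.

Lemma boxes_cover : \bigcup_j box (fun=> - (j%:R : R)) = setT.
Proof.
apply/seteqP; split => // x _.
pose c := \sum_q `|x q|; exists (Num.truncn c).+1 => // q.
rewrite ltrNl; apply: le_lt_trans (truncnS_gt c).
apply: (@le_trans _ _ `|x q|); first by rewrite -normrN ler_norm.
by rewrite /c (bigD1 q) //= lerDl sumr_ge0.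
Qed.

Lemma measurable_box b : measurable (box b : set V).
Proof. by apply: sub_sigma_algebra; exists b. Qed.

Lemma box_measure_unique (m1 m2 : {measure set V -> \bar R}) :
  (forall b, m1 (box b) = m2 (box b)) -> (forall b, (m1 (box b) < +oo)%E) ->
  forall A : set V, measurable A -> m1 A = m2 A.
Proof.
move=> e f A mA.
apply: (@measure_unique _ R V boxes (fun j => box (fun=> - (j%:R : R)))) => //.
- exact: boxes_setI.
- by move=> j; exists (fun=> - (j%:R : R)).
- exact: boxes_cover.
- by move=> _ [b _ <-]; exact: e.
Qed.

Lemma measurable_coord p : measurable_fun setT (fun x : V => x p).
Proof.
apply: (measurability _ (measurable_realfun.RGenOInfty.measurableE R)) => _ [_ [c ->] <-].
rewrite setTI (_ : _ @^-1` _ =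
  \bigcup_j (box (fun q => if q == p then c else - (j%:R : R)) : set V)).
  by apply: bigcupT_measurable => j; exact: measurable_box.
apply/seteqP; split => [x|x [j _ h]] /=; rewrite in_itv /= andbT; last first.
  by have := h p; rewrite eqxx.
move=> cx; have : [set: I -> R] x by [].
rewrite -boxes_cover => -[j _ h]; exists j => // q; case: eqP => [->//|_]; exact: h.
Qed.

Lemma measurable_into d (T : measurableType d) (phi : T -> V) :
  (forall q, measurable_fun setT (fun w => phi w q)) -> measurable_fun setT phi.
Proof.
move=> m; apply: (@measurability _ _ T V setT phi boxes) => // _ [_ [b _ <-] <-].
rewrite setTI; apply: (measurable_forall (A := fun q => [set w | b q < phi w q])) => q.
rewrite (_ : [set w | _] = (fun w => phi w q) @^-1` `]b q, +oo[).
  by rewrite -[X in measurable X]setTI; exact: m.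
by apply/seteqP; split => w /=; rewrite in_itv /= andbT.
Qed.

End Boxes.

Section Exponential.
Context (R : realType) (d : measure_display) (T : measurableType d).
Variables (P : probability T R) (X : T -> R) (a : R).
Hypotheses (mX : measurable_fun setT X) (eX : exponential_rv P X a).

Lemma measurable_tail b : measurable [set w | b < X w].
Proof.
rewrite (_ : [set w | _] = X @^-1` `]b, +oo[).
  by rewrite -[Y in measurable Y]setTI; exact: mX.
by apply/seteqP; split => w /=; rewrite in_itv /= andbT.
Qed.

Lemma exponential_tail b : P [set w | b < X w] = (expR (- (a * Num.max b 0)))%:E.
Proof.
have [a0 h] := eX; have [b0|b0] := leP 0 b; first exact: h.
rewrite mulr0 oppr0 expR0; apply/eqP; rewrite eq_le; apply/andP; split.
  by apply: probability_le1; exact: measurable_tail.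
rewrite (_ : 1%:E = P [set w | 0 < X w]); last by rewrite h // mulr0 oppr0 expR0.
apply: le_measure; rewrite ?inE; [exact: measurable_tail|exact: measurable_tail|].
by move=> w /=; exact: lt_trans.
Qed.

Lemma exponential_cdf s : P [set w | X w <= s] = (1 - expR (- (a * Num.max s 0)))%:E.
Proof.
rewrite (_ : [set w | _] = ~` [set w | s < X w]).
  by rewrite probability_setC ?exponential_tail //; exact: measurable_tail.
by apply/seteqP; split => w /=; [move=> h; apply/negP; rewrite -leNgt|move/negP; rewrite -leNgt].
Qed.

End Exponential.

Section ExponentialLaplace.
Context (R : realType).
Notation mu := (@lebesgue_measure R).

Lemma integral_expR_tail (c x : R) : 0 < c ->
  (\int[mu]_(s in `[x, +oo[) (c * expR (- (c * s)))%:E = (expR (- (c * x)))%:E)%E.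
Proof.
move=> c0.
have cF : continuous (fun s : R => expR (- (c * s))).
  move=> s; apply: (@continuous_comp _ _ _ (fun s => - (c * s)) expR); last exact: continuous_expR.
  by apply: cvgN; apply: cvgM; [exact: cvg_cst|exact: cvg_id].
rewrite (@ge0_continuous_FTC2y _ _ (fun s => - expR (- (c * s))) _ 0).
- by rewrite sub0e EFinN oppeK.
- by move=> s _; rewrite mulr_ge0 ?expR_ge0 // ltW.
- apply: continuous_subspaceT => s.
  by apply: cvgM; [exact: cvg_cst|exact: cF].
- rewrite -oppr0; apply: cvgN.
  rewrite (_ : (fun s => expR (- (c * s))) = (fun z => expR (- z)) \o (fun z => c * z)) //.
  apply: (@cvg_comp _ _ _ _ _ _ (pinfty_nbhs R)); last exact: cvgr_expR.
  exact: gt0_cvgMry.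
- by move=> s _; apply: ex_derive.
- by apply: cvgN; apply/cvg_at_right_filter; exact: cF.
- by move=> s _; rewrite derive1E derive_val scaler1 mulrN opprK mulrC.
Qed.

Context (d : measure_display) (T : measurableType d).
Variables (P : probability T R) (X : T -> R) (a : R).
Hypotheses (mX : measurable_fun setT X) (eX : exponential_rv P X a).

Lemma exponential_laplace c : 0 <= c ->
  (\int[P]_w (expR (- (c * X w)))%:E = (a / (a + c))%:E)%E.
Proof.
have [a0 _] := eX; rewrite le_eqVlt => /orP[/eqP <-|c0].
  under eq_integral do rewrite mul0r oppr0 expR0.
  by rewrite integral_cst //= probability_setT mule1 addr0 divff // gt_eqF.
pose f (z : T * R) : \bar R := if X z.1 <= z.2 then (c * expR (- (c * z.2)))%:E else 0%E.
have f0 z : (0 <= f z)%E.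
  by rewrite /f; case: ifP => // _; rewrite lee_fin mulr_ge0 ?expR_ge0 // ltW.
have mf : measurable_fun setT f.
  apply: measurable_fun_ifT => //.
  - apply: measurable_fun_ler => //; apply: measurableT_comp => //; exact: measurable_fst.
  - apply/measurable_EFinP; apply: measurable_funM => //.
    apply: measurableT_comp => //; apply: measurableT_comp => //.
    by apply: measurable_funM => //.
transitivity (\int[P]_w \int[mu]_s f (w, s))%E.
  apply: eq_integral => w _; rewrite -integral_expR_tail // integral_mkcond.
  apply: eq_integral => s _; rewrite /f patchE /=.
  by rewrite mem_setE in_itv /= andbT.
rewrite fubini_tonelli //.
have ac0 : 0 < a + c by rewrite addr_gt0.
transitivity (\int[mu]_s ((exponential_pdf c s)%:E -
   (c / (a + c))%:E * (exponential_pdf (a + c) s)%:E))%E.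
  apply: eq_integral => s _.
  transitivity ((c * expR (- (c * s)))%:E * P [set w | X w <= s]%R)%E.
    rewrite -integral_cst; last first.
      rewrite (_ : [set w | _] = X @^-1` `]-oo, s]).
        by rewrite -[Y in measurable Y]setTI; exact: mX.
      by apply/seteqP; split => w /=; rewrite in_itv /=.
    rewrite integral_mkcond; apply: eq_integral => w _; rewrite /f patchE /=.
    by rewrite mem_setE.
  rewrite (exponential_cdf mX eX) -!EFinM -EFinB; congr EFin.
  have [s0|s0] := leP 0 s; last first.
    by rewrite !lt0_exponential_pdf // !mulr0 oppr0 expR0 subrr mulr0 addr0.
  rewrite !exponential_pdfE // mulrBr mulr1 mulNr; congr (_ - _).
  rewrite mulrA divfK ?gt_eqF // -mulrA -expRD; congr (_ * expR _); ring.
rewrite integralB //=; last first.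
- under eq_fun do rewrite -EFinM.
  have := integrableZl measurableT (c / (a + c)) (integrable_exponential_pdf ac0).
  by [].
- exact: integrable_exponential_pdf.
rewrite integral_exponential_pdf // integralZl //=; last exact: integrable_exponential_pdf.
rewrite integral_exponential_pdf // mule1 -EFinB; congr EFin; field; exact: lt0r_neq0.
Qed.

End ExponentialLaplace.

Section Memoryless.
Context (R : realType) (d : measure_display) (T : measurableType d) (I : finType).
Variables (P : probability T R) (Z : {set I}) (M : I -> {RV P >-> R}) (rate : I -> R).
Hypotheses (M_zero : forall p, p \in Z -> forall w, M p w = 0)
  (M_exp : forall p, p \notin Z -> exponential_rv P (M p) (rate p))
  (M_indep : mutually_independent (~: Z) M).
Notation V := (g_sigma_algebraType (@boxes R I)).

Let mM q : measurable_fun setT (M q).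
Proof. exact: measurable_funPT. Qed.

Definition entries (w : T) : V := fun q => M q w.

Lemma measurable_entries : measurable_fun setT entries.
Proof. by apply: measurable_into => q; exact: mM. Qed.

Lemma independent_tails (J : {set I}) (b : I -> R) :
  P [set w | forall q, q \in J -> b q < M q w] =
  (\prod_(q in J) P [set w | (b q < M q w)%R])%E.
Proof.
have [/existsP[q /and3P[qJ qZ bq]]|] := boolP [exists q, [&& q \in J, q \in Z & 0 <= b q]].
  rewrite (bigD1 q) //= (_ : [set w | b q < M q w] = set0) ?measure0 ?mul0e.
    rewrite (_ : [set w | _] = set0) ?measure0 //; apply/seteqP; split => // w /(_ q qJ).
    by rewrite M_zero // ltNge bq.
  by apply/seteqP; split => // w /=; rewrite M_zero // ltNge bq.
rewrite negb_exists => /forallP hb.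
have hZ q w : q \in J -> q \in Z -> b q < M q w.
  by move=> qJ qZ; rewrite M_zero //; have := hb q; rewrite qJ qZ /= -ltNge.
have := @M_indep (J :&: ~: Z) (fun q => `]b q, +oo[) (finset.subsetIr _ _) (fun=> measurable_itv _).
rewrite (_ : [set w | _] = [set w | forall q, q \in J -> b q < M q w]).
  move=> ->; rewrite [RHS](bigID (mem Z)) /= [X in (X * _)%E]big1 ?mul1e.
    apply: eq_big => [q|q _]; first by rewrite !inE.
    by congr (P _); apply/seteqP; split => w /=; rewrite in_itv /= andbT.
  move=> q /andP[qJ qZ]; rewrite (_ : [set w | _] = setT) ?probability_setT //.
  by apply/seteqP; split => // w _; exact: hZ.
apply/seteqP; split => w /= h q; last first.
  by rewrite finset.in_setI => /andP[qJ _]; rewrite in_itv /= andbT; exact: h.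
move=> qJ; have [qZ|qZ] := boolP (q \in Z); first exact: hZ.
by have := h q; rewrite finset.in_setI finset.in_setC qJ qZ in_itv /= andbT; apply.
Qed.

Lemma entries_box b :
  P (entries @^-1` box b) = (\prod_q P [set w | (b q < M q w)%R])%E.
Proof.
rewrite (eq_bigl (mem [set: I]%SET)); last by move=> q; rewrite !inE.
rewrite -independent_tails; congr (P _); apply/seteqP; split => w /= h q; first by [].
by apply: h; rewrite inE.
Qed.

Definition residual (D : {set I}) (y : R) (x : V) : V :=
  fun q => if q \in D then x q - y else x q.

Lemma measurable_residual_entries D y : measurable_fun setT (fun w => residual D y (entries w)).
Proof.
apply: measurable_into => q; rewrite /residual; case: (q \in D); last exact: mM.
by apply: measurable_funB => //; exact: mM.
Qed.

Lemma measurable_exceed (D : {set I}) y :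
  measurable [set w | forall q, q \in D -> y < M q w].
Proof. by apply: measurable_forall_in => q _; apply: measurable_tail; exact: mM. Qed.

Lemma memoryless_box (D : {set I}) y b : D \subset ~: Z -> 0 <= y ->
  P ([set w | forall q, q \in D -> y < M q w] `&`
     (fun w => residual D y (entries w)) @^-1` box b) =
  ((expR (- ((\sum_(q in D) rate q) * y)))%:E * P (entries @^-1` box b))%E.
Proof.
move=> /fintype.subsetP DZ y0; pose b' q := if q \in D then Num.max y (b q + y) else b q.
rewrite entries_box (_ : _ `&` _ = entries @^-1` box b'); last first.
  apply/seteqP; split => w /=.
    move=> [h1 h2] q; have := h2 q; rewrite /b' /residual; case: ifP => // qD.
    by rewrite gt_max h1 //= ltrBrDr.
  move=> h; split => q; have := h q; rewrite /b' /residual.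
    by move=> + qD; rewrite qD gt_max => /andP[].
  by case: ifP => // qD; rewrite gt_max ltrBrDr => /andP[].
rewrite entries_box (bigID (mem D)) [X in _ = (_ * X)%E](bigID (mem D)) /= muleA.
congr (_ * _)%E; last first.
  by apply: eq_bigr => q qD; rewrite /b' (negbTE qD).
rewrite mulr_suml -sumrN expR_sum -prodEFin -big_split /=.
apply: eq_bigr => q qD; have qZ : q \notin Z by have := DZ q qD; rewrite inE.
rewrite !(exponential_tail (mM q) (M_exp qZ)) -EFinM -expRD; congr (expR _)%:E.
rewrite /b' qD -opprD -mulrDr; congr (- (_ * _)).
have [h|h] := leP 0 (b q).
  by rewrite (@max_r _ _ y (b q + y)) ?lerDr // max_l ?addr_ge0 // addrC.
by rewrite (@max_l _ _ y (b q + y)) ?gerDr ?(ltW h) // max_l // addr0.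
Qed.

Lemma memoryless (D : {set I}) (y : R) (h : V -> \bar R) : D \subset ~: Z -> 0 <= y ->
  measurable_fun setT h -> (forall x, (0 <= h x)%E) ->
  (\int[P]_(w in [set w | forall q, q \in D -> (y < M q w)%R]) h (residual D y (entries w)) =
   (expR (- ((\sum_(q in D) rate q) * y)))%:E * \int[P]_w h (entries w))%E.
Proof.
move=> DZ y0 mh h0; set E := [set w | _]; set c := expR _.
have mE : measurable E := measurable_exceed D y.
have c0 : 0 <= c by rewrite expR_ge0.
have ms := measurable_residual_entries D y.
pose sh (w : T) : V := residual D y (entries w).
pose m1 : {measure set V -> \bar R} := pushforward (mrestr P mE) sh.
pose m2 : {measure set V -> \bar R} :=
  mscale (NngNum c0) (pushforward P entries).
have m12 (A : set V) : measurable A -> m1 ms A = m2 measurable_entries A.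
  apply: box_measure_unique => b.
    rewrite /m1 /m2 /= /mscale /pushforward /mrestr /= setIC.
    exact: memoryless_box.
  rewrite /m1 /pushforward /mrestr /=; apply: le_lt_trans (ltry 1).
  apply: probability_le1; apply: measurableI => //.
  by rewrite -[X in measurable X]setTI; apply: ms => //; exact: measurable_box.
transitivity (\int[m1 ms]_x h x)%E.
  rewrite ge0_integral_pushforward // preimage_setT -[in RHS](setUv E).
  have mhs : measurable_fun setT (h \o sh) by exact: measurableT_comp.
  rewrite ge0_integral_setU //.
  - rewrite [X in _ = (_ + X)%E]null_set_integral ?adde0.
    + apply: eq_measure_integral => A mA AE.
      by rewrite /= /mrestr setIidl.
    + exact: measurableC.
    + exact: measurable_funTS.
    + by rewrite /= /mrestr setICl measure0.
  - exact: measurableC.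
  - exact: measurable_funTS.
  - by move=> x _; exact: h0.
  - exact/disj_setPCl.
rewrite (eq_measure_integral (m2 measurable_entries)); last by move=> A mA _; exact: m12.
rewrite ge0_integral_mscale //; congr (_ * _)%E.
by rewrite ge0_integral_pushforward //; exact: measurable_entries.
Qed.

Lemma positive_ae : exists N : set T,
  [/\ measurable N, P N = 0%E & forall w, ~ N w -> forall q, q \notin Z -> 0 < M q w].
Proof.
have mE : measurable [set w | forall q, q \in ~: Z -> 0 < M q w].
  by apply: measurable_forall_in => q _; apply: measurable_tail; exact: mM.
exists (~` [set w | forall q, q \in ~: Z -> 0 < M q w]); split.
- exact: measurableC.
- rewrite probability_setC // independent_tails big1 ?subee // => q; rewrite inE => qZ.
  by rewrite (exponential_tail (mM q) (M_exp qZ)) maxxx mulr0 oppr0 expR0.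
- by move=> w /contrapT h q qZ; apply: h; rewrite inE.
Qed.

Definition splice p (z : T * T) : V := fun q => if q == p then M p z.2 else M q z.1.

Lemma measurable_splice p : measurable_fun setT (splice p).
Proof.
apply: measurable_into => q; rewrite /splice; case: (q == p).
  by apply: measurableT_comp; [exact: mM|exact: measurable_snd].
by apply: measurableT_comp; [exact: mM|exact: measurable_fst].
Qed.

Lemma splice_box p b : (P \x P)%E (splice p @^-1` box b) = P (entries @^-1` box b).
Proof.
rewrite entries_box (bigD1 p) //= muleC.
rewrite (_ : _ @^-1` _ = [set w | forall q, q \in [set~ p]%SET -> b q < M q w] `*`
                         [set w | b p < M p w]); last first.
  apply/seteqP; split => -[w w'] /=.
    move=> h; split => [q|]; last by have := h p; rewrite /splice eqxx.
    by rewrite !inE => qp; have := h q; rewrite /splice (negbTE qp).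
  move=> [h1 h2] q; rewrite /splice; case: eqP => [->//|/eqP qp].
  by apply: h1; rewrite !inE.
rewrite product_measure1E; last 2 first.
- by apply: measurable_forall_in => q _; apply: measurable_tail; exact: mM.
- by apply: measurable_tail; exact: mM.
congr (_ * _)%E.
transitivity (\prod_(q in [set~ p]%SET) P [set w | (b q < M q w)%R])%E.
  exact: independent_tails.
by apply: eq_bigl => q; rewrite !inE.
Qed.

Lemma integral_splice p (h : V -> \bar R) : measurable_fun setT h ->
  (forall x, (0 <= h x)%E) ->
  (\int[P]_w h (entries w) = \int[P]_w' \int[P]_w h (splice p (w, w')))%E.
Proof.
move=> mh h0; have ms := @measurable_splice p.
pose m1 : {measure set V -> \bar R} := pushforward (P \x P)%E (splice p).
pose m2 : {measure set V -> \bar R} := pushforward P entries.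
have m12 (A : set V) : measurable A -> m2 measurable_entries A = m1 ms A.
  apply: box_measure_unique => b; first by rewrite /m1 /m2 /= /pushforward splice_box.
  rewrite /m2 /= /pushforward; apply: le_lt_trans (ltry 1).
  apply: probability_le1; rewrite -[X in measurable X]setTI.
  by apply: measurable_entries => //; exact: measurable_box.
transitivity (\int[m2 measurable_entries]_x h x)%E.
  by rewrite ge0_integral_pushforward //; exact: measurable_entries.
rewrite (eq_measure_integral (m1 ms)); last by move=> A mA _; exact: m12.
rewrite ge0_integral_pushforward // preimage_setT.
rewrite fubini_tonelli2 //.
- by apply: measurableT_comp.
- by move=> x; exact: h0.
Qed.

Definition wins (S : {set I}) p : set V := [set x | forall q, q \in S :\ p -> x p < x q].

Lemma measurable_wins S p : measurable (wins S p).
Proof.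
apply: (measurable_forall_in (A := fun q => [set x : V | x p < x q])) => q _.
rewrite (_ : [set x | _] = (fun x : V => x q - x p) @^-1` `]0, +oo[).
  rewrite -[X in measurable X]setTI.
  have : measurable_fun setT (fun x : V => x q - x p).
    by apply: measurable_funB; exact: measurable_coord.
  by apply.
by apply/seteqP; split => x /=; rewrite in_itv /= andbT subr_gt0.
Qed.

Lemma competition p (S : {set I}) (t : R) (h : V -> R) :
  p \in S -> S \subset ~: Z -> 0 <= t ->
  measurable_fun setT h -> (forall x, 0 <= h x) ->
  (forall x x' : V, (forall q, q != p -> x q = x' q) -> h x = h x') ->
  (\int[P]_w (\1_(wins S p) (entries w) * expR (- (t * M p w)) *
               h (residual (S :\ p) (M p w) (entries w)))%:E =
   (rate p / (\sum_(q in S) rate q + t))%:E * \int[P]_w (h (entries w))%:E)%E.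
Proof.
move=> pS SZ t0 mh h0 hp; set D := S :\ p; set K := (\int[P]_w (h (entries w))%:E)%E.
have DZ : D \subset ~: Z by apply: fintype.subset_trans SZ; exact: finset.subD1set.
have pZ : p \notin Z by have := fintype.subsetP SZ p pS; rewrite inE.
have rate_ge0 q : q \notin Z -> 0 < rate q by move=> /M_exp[].
set c := \sum_(q in D) rate q.
have c0 : 0 <= c.
  by apply: sumr_ge0 => q /(fintype.subsetP DZ); rewrite inE => /rate_ge0/ltW.
have K0 : (0 <= K)%E by apply: integral_ge0 => w _; rewrite lee_fin.
pose G (x : V) : \bar R :=
  (\1_(wins S p) x * expR (- (t * x p)) * h (residual D (x p) x))%:E.
have G0 x : (0 <= G x)%E by rewrite lee_fin !mulr_ge0 ?expR_ge0 // indicE.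
have mG : measurable_fun setT G.
  apply/measurable_EFinP; apply: measurable_funM.
    apply: measurable_funM; first by apply: measurable_indic; exact: measurable_wins.
    apply: measurableT_comp => //; apply: measurableT_comp => //.
    by apply: measurable_funM => //; exact: measurable_coord.
  apply: measurableT_comp => //; apply: measurable_into => q; rewrite /residual.
  case: (q \in D); last exact: measurable_coord.
  by apply: measurable_funB; exact: measurable_coord.
rewrite [LHS](integral_splice p mG G0).
have inner w' : 0 < M p w' ->
    (\int[P]_w G (splice p (w, w')) = (expR (- ((t + c) * M p w')))%:E * K)%E.
  move=> y0; set y := M p w'.
  transitivity (\int[P]_(w in [set w | forall q, q \in D -> (y < M q w)%R])
     ((expR (- (t * y)))%:E * (h (residual D y (entries w)))%:E))%E.
    rewrite [RHS]integral_mkcond; apply: eq_integral => w _; rewrite patchE /G.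
    have sp : splice p (w, w') p = y by rewrite /splice eqxx.
    rewrite sp (hp _ (residual D y (entries w))); last first.
      by move=> q qp; rewrite /residual /splice (negbTE qp).
    have e : (splice p (w, w') \in wins S p) =
             (w \in [set w | forall q, q \in D -> (y < M q w)%R]).
      apply/idP/idP; rewrite !inE /wins /= => hw q qD; have := hw q qD;
        rewrite sp /splice; case: eqP => // qp; move: qD; rewrite qp /D !inE eqxx //.
    by rewrite indicE e; case: (w \in _); rewrite ?mul1r ?mul0r // EFinM.
  rewrite ge0_integralZl_EFin //; last 3 first.
  - exact: measurable_exceed.
  - by move=> w _; rewrite lee_fin.
  - apply/measurable_EFinP; apply: measurable_funTS; apply: measurableT_comp => //.
    exact: measurable_residual_entries.
  rewrite (@memoryless D y (fun x => (h x)%:E) DZ (ltW y0)) //; last exact/measurable_EFinP.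
  by rewrite muleA -EFinM -expRD -/c -/K; congr ((expR _)%:E * _)%E; ring.
have mexp : measurable_fun setT (fun w' => (expR (- ((t + c) * M p w')))%:E).
  apply/measurable_EFinP; apply: measurableT_comp => //; apply: measurableT_comp => //.
  by apply: measurable_funM => //; exact: mM.
transitivity (\int[P]_w' ((expR (- ((t + c) * M p w')))%:E * K))%E.
  apply: ge0_ae_eq_integral => //.
  - apply: (measurable_fun_fubini_tonelli_G (G \o splice p)) => //.
    by apply: measurableT_comp => //; exact: measurable_splice.
  - by move=> z; exact: G0.
  - by apply: emeasurable_funM => //; exact: measurable_cst.
  - by move=> w' _; apply: integral_ge0 => w _; exact: G0.
  - by move=> w' _; rewrite mule_ge0 // lee_fin expR_ge0.
  - have [N [mN N0 hN]] := positive_ae; exists N; split => //.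
    move=> w' /= nw; apply: contrapT => nN; apply: nw => _; apply: inner.
    exact: hN pZ.
rewrite ge0_integralZr //.
- rewrite (exponential_laplace (mM p) (M_exp pZ)) ?addr_ge0 //.
  congr ((_ / _)%:E * _)%E.
  rewrite [in RHS](bigD1 p) //= -addrA; congr (_ + _); rewrite addrC; congr (_ + _).
  by apply: eq_bigl => q; rewrite !inE andbC.
Qed.

End Memoryless.

(** * The Laplace transform of the minimum k-assignment *)

Lemma measurable_fin_min (R : realType) (d : measure_display) (U : measurableType d)
    (J : finType) (A : {set J}) (f : J -> U -> R) :
  (forall j, measurable_fun setT (f j)) ->
  measurable_fun setT (fun x => fin_min A (fun j => f j x)).
Proof.
move=> mf; apply: measurableT_comp; first exact: fine_measurable.
elim: (index_enum J) => [|j s IH].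
  under eq_fun do rewrite big_nil; exact: measurable_cst.
under eq_fun do rewrite big_cons.
case: (j \in A); last exact: IH.
by apply: measurable_mine => //; exact/measurable_EFinP.
Qed.

Section LaplaceTransform.
Context (R : realType) (d : measure_display) (T : measurableType d).
Variables (P : probability T R) (m n k : nat) (Z : {set pos m n})
  (M : pos m n -> {RV P >-> R}) (rate : pos m n -> R).
Hypotheses (k_gt0 : (0 < k)%N) (k_le : (k <= minn m n)%N)
  (M_zero : forall p, p \in Z -> forall w, M p w = 0)
  (M_exp : forall p, p \notin Z -> exponential_rv P (M p) (rate p))
  (M_indep : mutually_independent (~: Z) M)
  (Z_indep : independent_zeros k Z).
Notation V := (g_sigma_algebraType (@boxes R (pos m n))).
Notation entries := (entries M).

Lemma rate_gt0 p : p \notin Z -> 0 < rate p.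
Proof. by move=> /M_exp[]. Qed.

Definition zeroed (Z' : {set pos m n}) (x : pos m n -> R) q : R :=
  if q \in Z' then 0 else x q.

Definition min_zeroed Z' (x : V) : R := min_assignment k (zeroed Z' x).

Lemma measurable_min_zeroed Z' : measurable_fun setT (min_zeroed Z').
Proof.
apply: measurable_fin_min => A.
rewrite [X in measurable_fun _ X](_ : _ = fun x : V => \sum_(q <- enum A) zeroed Z' x q).
  apply: measurable_sum => q.
  rewrite /zeroed; case: (q \in Z'); [exact: measurable_cst|exact: measurable_coord].
by apply/funext => x; rewrite big_enum.
Qed.

Lemma eq_min_assignment (x y : pos m n -> R) :
  x =1 y -> min_assignment k x = min_assignment k y.
Proof. by move=> e; apply: eq_fin_min => A _; apply: eq_bigr => q _. Qed.

Lemma measurable_expR_min Z' (t : R) :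
  measurable_fun setT (fun x : V => expR (- (t * min_zeroed Z' x))).
Proof.
apply: measurableT_comp => //; apply: measurableT_comp => //.
by apply: measurable_funM => //; exact: measurable_min_zeroed.
Qed.

Lemma wins_unique (S : {set pos m n}) (x : V) p q : p \in S -> q \in S ->
  wins S p x -> wins S q x -> p = q.
Proof.
move=> pS qS hp hq; apply/eqP; apply: contraT => pq.
have h1 := hp q; have h2 := hq p; move: h1 h2; rewrite !in_setD1 pS qS pq eq_sym pq /=.
by move=> /(_ isT) h1 /(_ isT) /(lt_trans h1); rewrite ltxx.
Qed.

Lemma wins_ae (S : {set pos m n}) : S \subset ~: Z -> S != finset.set0 ->
  exists N : set T, [/\ measurable N, P N = 0%E &
    forall w, ~ N w -> exists2 p, p \in S & wins S p (entries w)].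
Proof.
move=> SZ S0.
pose W := \bigcup_(p in [set p | p \in S]) (entries @^-1` wins S p).
have mE p : measurable (entries @^-1` wins S p).
  by rewrite -[X in measurable X]setTI; apply: measurable_entries => //; exact: measurable_wins.
have mW : measurable W.
  by apply: fin_bigcup_measurable => [|p _]; [exact: finite_finset|exact: mE].
have I0 : 0 < \sum_(q in S) rate q.
  have /set0Pn[p pS] := S0.
  have pos q : q \in S -> 0 < rate q.
    by move=> /(fintype.subsetP SZ); rewrite inE; exact: rate_gt0.
  rewrite (bigD1 p) //= ltr_wpDr ?pos // sumr_ge0 // => q /andP[qS _]; exact/ltW/pos.
exists (~` W); split; first exact: measurableC.
  rewrite probability_setC // -[X in P X](setIT W) -integral_indic //.
  transitivity (1 - \int[P]_w \sum_(p <- enum S) (\1_(wins S p) (entries w))%:E)%E.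
    congr (1 - _)%E; apply: eq_integral => w _; rewrite big_enum /= sumEFin; congr EFin.
    rewrite indicE; case: (boolP (w \in W)) => [|nW].
      rewrite inE => -[p /= pS pw]; rewrite (bigD1 p) //= big1 ?addr0.
        by rewrite indicE mem_set.
      move=> q /andP[qS qp]; rewrite indicE memNset // => qw.
      by case/eqP: qp; exact: wins_unique qw pw.
    rewrite big1 // => p pS; rewrite indicE memNset // => pw.
    by case/negP: nW; rewrite inE; exists p.
  rewrite ge0_integral_sum //; last first.
    move=> p; apply/measurable_EFinP; apply: measurableT_comp.
      by apply: measurable_indic; exact: measurable_wins.
    exact: measurable_entries.
  have key p : p \in S ->
      (\int[P]_w (\1_(wins S p) (entries w))%:E = (rate p / \sum_(q in S) rate q)%:E)%E.
    move=> pS; have := competition M_zero M_exp M_indep (h := fun=> 1) pS SZ (lexx 0).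
    rewrite addr0 integral_cst //= probability_setT !mule1 => <- //.
    by apply: eq_integral => w _; rewrite mul0r oppr0 expR0 !mulr1.
  rewrite big_enum /= (eq_bigr _ key) sumEFin -mulr_suml divff ?gt_eqF //.
  by rewrite subee.
by move=> w /contrapT[p /= pS pw]; exists p.
Qed.

Lemma laplace_growth N (t : R) (Z' : {set pos m n}) : 0 <= t -> Z \subset Z' -> (#|~: Z'| < N)%N ->
  (\int[P]_w (expR (- (t * min_zeroed Z' (entries w))))%:E =
   (growth_laplace k N rate t Z')%:E)%E.
Proof.
move=> t0; elim: N Z' => // N IH Z' sZ hN /=.
have iZ' := independent_zeros_sub sZ Z_indep.
have [N1 [mN1 N10 hN1]] := positive_ae M_zero M_exp M_indep.
have mexp : measurable_fun setT (fun w => (expR (- (t * min_zeroed Z' (entries w))))%:E).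
  apply/measurable_EFinP; apply: (measurableT_comp (measurable_expR_min Z' t)).
  exact: measurable_entries.
have x_ge0 w : ~ N1 w -> forall q, 0 <= zeroed Z' (entries w) q.
  move=> nw q; rewrite /zeroed; case: ifP => // /negbT qZ'.
  by apply/ltW/hN1 => //; apply: contra qZ'; exact: (fintype.subsetP sZ).
case: pickP => [al /asboolP mal|none]; last first.
  have Q0 : critical k Z' = finset.set0.
    apply/eqP; apply: contraT => /(critical_minimum_cover iZ')[al mal].
    by have := none al; rewrite asboolT.
  have [A Ak /fintype.subsetP AZ'] := critical0_zeros k_gt0 iZ' Q0.
  transitivity (\int[P]_w (cst 1%E w))%E; last by rewrite integral_cst //= probability_setT mule1.
  apply: ge0_ae_eq_integral => //.
  exists N1; split => // w /= nw; apply: contrapT => nN; apply: nw => _.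
  suff -> : min_zeroed Z' (entries w) = 0 by rewrite mulr0 oppr0 expR0.
  apply/eqP; rewrite eq_le; apply/andP; split.
    apply: le_trans (fin_min_le _ Ak) _.
    by rewrite big1 // => q /AZ' qZ'; rewrite /zeroed qZ'.
  apply: fin_min_ge; first exact: assignments_neq0.
  by move=> B _; apply: sumr_ge0 => q _; exact: x_ge0.
set S := rect_of al.
have SQ' : S \in critical k Z' by apply: rect_of_critical; exact: mal.1.
have S_Z' q : q \in S -> q \notin Z' by exact: (rect_disjoint SQ').
have SZ : S \subset ~: Z.
  apply/fintype.subsetP => q /S_Z'; rewrite inE; apply: contra; exact: (fintype.subsetP sZ).
have [N2 [mN2 N20 hN2]] := wins_ae SZ (critical_neq0 k_gt0 k_le SQ').
pose term p w : R := \1_(wins S p) (entries w) * expR (- (t * M p w)) *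
  expR (- (t * min_zeroed (p |: Z') (residual (S :\ p) (M p w) (entries w)))).
have mterm p : measurable_fun setT (fun w => (term p w)%:E).
  apply/measurable_EFinP; apply: measurable_funM.
    apply: measurable_funM.
      apply: measurableT_comp; last exact: measurable_entries.
      by apply: measurable_indic; exact: measurable_wins.
    apply: measurableT_comp => //; apply: measurableT_comp => //.
    by apply: measurable_funM.
  apply: (measurableT_comp (measurable_expR_min (p |: Z') t)).
  apply: measurable_into => q; rewrite /residual; case: (q \in _); last by [].
  by apply: measurable_funB.
have term0 p w : (0 <= (term p w)%:E)%E.
  by rewrite lee_fin !mulr_ge0 ?expR_ge0 // indicE.
transitivity (\int[P]_w \sum_(p <- enum S) (term p w)%:E)%E.
  apply: ge0_ae_eq_integral => //.
  - by apply: emeasurable_sum.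
  - by move=> w _; apply: sume_ge0 => p _; exact: term0.
  exists (N1 `|` N2); split; first exact: measurableU.
    by apply/eqP; rewrite eq_le measure_ge0 andbT -[0%E](adde0 0%E) -{1}N10 -N20 measureU2.
  move=> w /= nw; apply: contrapT => /not_orP[nN1 nN2]; apply: nw => _.
  have [p pS pw] := hN2 w nN2.
  rewrite big_enum /= (bigD1 p) //= big1 ?adde0; last first.
    move=> q /andP[qS qp]; rewrite /term indicE memNset ?mul0r // => qw.
    by case/eqP: qp; exact: wins_unique qw pw.
  rewrite /term indicE mem_set // mul1r -expRD -opprD -mulrDr; congr (expR (- (t * _)))%:E.
  have zp q : q \in S -> zeroed Z' (entries w) q = M q w.
    by move=> /S_Z' h; rewrite /zeroed (negbTE h).
  rewrite /min_zeroed (@min_assignment_step _ _ _ R Z' al _ p k_gt0 k_le iZ' mal) //.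
  - rewrite zp //; congr (_ + _); apply: eq_min_assignment => q.
    rewrite -/S /zeroed /residual in_setU1 in_setD1.
    have [->|qp] := eqVneq q p; first by rewrite pS (negbTE (S_Z' p pS)) subrr.
    have [qS|qS] //= := boolP (q \in S).
    by rewrite (negbTE (S_Z' q qS)) ?(negbTE (S_Z' p pS)).
  - exact: x_ge0.
  - by move=> q qZ'; rewrite /zeroed qZ'.
  - move=> q qS; rewrite !zp //; have [->//|qp] := eqVneq q p.
    by apply/ltW/pw; rewrite in_setD1 qp.
rewrite ge0_integral_sum //.
rewrite big_enum /= -sumEFin; apply: eq_bigr => p pS.
rewrite EFinM -IH; last 2 first.
- by apply: fintype.subset_trans sZ _; exact: finset.subsetUr.
- rewrite -ltnS; apply: leq_trans hN; apply: proper_card; apply/properP; split.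
    by apply/fintype.subsetP => q; rewrite !inE negb_or => /andP[].
  by exists p; rewrite !inE ?eqxx // (S_Z' p pS).
apply: (competition M_zero M_exp M_indep
  (h := fun x => expR (- (t * min_zeroed (p |: Z') x))) pS SZ t0).
- exact: measurable_expR_min.
- by move=> x; rewrite expR_ge0.
- move=> x x' e; congr (expR (- (t * _))); apply: eq_min_assignment => q.
  rewrite /zeroed in_setU1; have [->|qp] := eqVneq q p; first by [].
  by rewrite (e q qp).
Qed.

Lemma exponential_fin_min S : S \in critical k Z ->
  exponential_rv P (fun w => fin_min S (fun p => M p w)) (rect_rate rate S).
Proof.
move=> SQ; split; first exact: (rect_rate_gt0 k_gt0 k_le rate_gt0 SQ).
move=> t t0.
transitivity (P [set w | forall q, q \in S -> t < M q w]).
  congr (P _); apply/seteqP; split => w /= h.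
    by move=> q qS; apply: lt_le_trans h _; exact: fin_min_le.
  by have [q qS ->] := fin_min_attained (fun p => M p w) (critical_neq0 k_gt0 k_le SQ); exact: h.
rewrite (independent_tails M_zero M_indep S (fun=> t)).
rewrite /rect_rate mulr_suml -sumrN expR_sum -prodEFin.
by apply: eq_bigr => q qS; have [_ ->] := M_exp (rect_disjoint SQ qS).
Qed.

End LaplaceTransform.

Local Open Scope ring_scope.

Theorem theorem4p1 (R : realType) (d : measure_display) (T : measurableType d)
    (P : probability T R) (m n k : nat) (Z : {set pos m n})
    (M : pos m n -> {RV P >-> R}) (rate : pos m n -> R)
    (k_gt0 : (0 < k)%N) (k_le : (k <= minn m n)%N)
    (M_zero : forall p, p \in Z -> forall w, M p w = 0)
    (M_exp : forall p, p \notin Z -> exponential_rv P (M p) (rate p))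
    (M_indep : mutually_independent (~: Z) M)
    (Z_indep : exists2 A, A \in assignments m n k.-1 & A \subset Z)
    (Q_neq0 : critical k Z != finset.set0) :
  let Q := critical k Z in
  let minM := fun w => min_assignment k (fun p => M p w) in
  let phi := fun S t => laplace P (fun w => fin_min S (fun p => M p w)) t in
  [/\ (forall S t, S \in Q -> 0 <= t ->
         phi S t = (rect_rate rate S / (rect_rate rate S + t))%:E),
      (generic k Z rate -> forall t, 0 <= t ->
         laplace P minM t = (\sum_(S in Q) (coef_c k Z rate S)%:E * phi S t)%E),
      (* non-generic rates: the right-hand side is extended by continuity
         from generic ones, its terms being undefined *)
      (forall (r : nat -> pos m n -> R),
         (forall j p, p \notin Z -> 0 < r j p) ->
         (forall j, generic k Z (r j)) ->
         (forall p, p \notin Z -> (fun j => r j p) @ \oo --> rate p) ->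
         forall t, 0 <= t ->
         (fun j => (\sum_(S in Q) coef_c k Z (r j) S *
                      (rect_rate (r j) S / (rect_rate (r j) S + t)))%:E)
           @ \oo --> laplace P minM t)
    & (forall S, S \in Q -> generic_at k Z rate S ->
         (exists h, incidence_inverse (rect_comparable k Z S) (rect_le k Z)
                      (g_fun k Z rate S) h) /\
         (forall (Q' : {set rectangle m n}) h,
            rect_comparable k Z S \subset Q' -> Q' \subset Q ->
            incidence_inverse Q' (rect_le k Z) (g_fun k Z rate S) h ->
            coef_c k Z rate S =
              (\sum_(S' in Q | rect_le k Z S' S) h S' S) *
              (\sum_(S' in Q | rect_le k Z S S') h S S')))].
Proof.
have rate_pos p : p \notin Z -> 0 < rate p by move=> /M_exp[].
have iZ : independent_zeros k Z := Z_indep.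

have phiE S t : S \in critical k Z -> 0 <= t ->
    laplace P (fun w => fin_min S (fun p => M p w)) t =
    (rect_rate rate S / (rect_rate rate S + t))%:E.
  move=> SQ t0; rewrite /laplace expectation.unlock.
  apply: exponential_laplace t0; first by apply: measurable_fin_min => p.
  exact: (exponential_fin_min k_gt0 k_le M_zero M_exp M_indep SQ).
have minE t : 0 <= t ->
    laplace P (fun w => min_assignment k (fun p => M p w)) t =
    (growth_laplace k #|~: Z|.+1 rate t Z)%:E.
  move=> t0; rewrite -(laplace_growth k_gt0 k_le M_zero M_exp M_indep iZ t0 (subxx Z) (ltnSn _)).
  rewrite /laplace expectation.unlock; apply: eq_integral => w _.
  congr (expR (- (t * _)))%:E; apply: eq_min_assignment => q; rewrite /zeroed.
  by case: ifP => // /M_zero ->.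
split.
- exact: phiE.
- move=> gen t t0; rewrite minE //.
  rewrite (growth_laplace_coef_c k_gt0 k_le rate_pos gen t0 iZ Q_neq0 (ltnSn _)) -sumEFin.
  by apply: eq_bigr => S SQ; rewrite phiE // EFinM.
- move=> r r_pos r_gen r_cvg t t0; rewrite minE //.
  apply: cvg_EFin; first by near=> j.
  rewrite (_ : fine \o _ = fun j => growth_laplace k #|~: Z|.+1 (r j) t Z).
    exact: growth_laplace_cvg.
  apply/funext => j /=; symmetry.
  exact: (growth_laplace_coef_c k_gt0 k_le (r_pos j) (r_gen j) t0 iZ Q_neq0 (ltnSn _)).
- move=> S SQ gen; split; first exact: (g_fun_inverse_exists k_gt0 k_le).
  by move=> Q' h; exact: (coef_c_g_inverse k_gt0 k_le).
Unshelve. all: by end_near.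
Qed.
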